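(* Consider a smooth monotone game whose gradient operator $V$ is $L$-Lipschitz ($L>0$). Let $\mu>0$ be a constant, and let $\kappa=\frac{\mu}{2}$, $\theta=\frac{3\mu^2+8L^2}{2\mu}$. Suppose that the noise assumption (stated in the context) holds and that $\|V(\pi)\|\le\zeta$ for any $\pi\in\mathcal{X}$. Assume also that $T_\sigma$ is set to satisfy $T_\sigma=c\cdot\max(T^{6/7},1)$ for some constant $c\ge 1$, where $T$ is the total number of iterations. If all players run GABP with noisy feedback, using the constant perturbation strength $\mu$, the update interval $T_\sigma$ and the decreasing learning rate sequence $\eta_t=\frac{1}{\kappa(t-T_\sigma(k(t)-1))+2\theta}$, then the strategy profile $\pi^{T+1}$ satisfies $$\mathbb{E}\left[\mathrm{GAP}(\pi^{T+1})\right]=\mathcal{O}\left(\frac{\ln T}{T^{1/7}}\right).$$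
   Context: Game. There are $N$ players; player $i\in[N]=\{1,\dots,N\}$ has a compact convex strategy space $\mathcal{X}_i\subset\mathbb{R}^{d_i}$, and $\mathcal{X}=\prod_{i\in[N]}\mathcal{X}_i$. Player $i$ has a payoff function $v_i:\mathcal{X}\to\mathbb{R}$, differentiable on $\mathcal{X}$, which she wants to maximize. Let $V(\pi)=(\nabla_{\pi_i}v_i(\pi))_{i\in[N]}$. The norm $\|\cdot\|$ is the $\ell_2$-norm. The game is smooth monotone: for all $\pi,\pi'\in\mathcal{X}$, $\langle V(\pi)-V(\pi'),\pi-\pi'\rangle\le 0$ and $\|V(\pi)-V(\pi')\|\le L\|\pi-\pi'\|$. The gap function is $\mathrm{GAP}(\pi)=\max_{\tilde\pi\in\mathcal{X}}\langle V(\pi),\tilde\pi-\pi\rangle$. GABP (Gradient Ascent with Boosting Payoff Perturbation). Given learning rates $\eta_t>0$, perturbation strength $\mu>0$, an update interval $T_\sigma$ (the number of iterations between updates of the anchoring strategy), and an initial profile $\pi^1\in\mathcal{X}$, put $k(t)=\lfloor (t-1)/T_\sigma\rfloor+1$ and $\sigma_i^{k}=\pi_i^{T_\sigma(k-1)+1}$ for $k\ge1$ (so $\sigma_i^1=\pi_i^1$). For $t=1,\dots,T$, each player $i$ receives feedback $\widehat\nabla_{\pi_i}v_i(\pi^t)$ and sets $$\pi_i^{t+1}=\arg\max_{x\in\mathcal{X}_i}\left\{\eta_t\left\langle \widehat\nabla_{\pi_i}v_i(\pi^t)-\mu\frac{\sigma_i^{k(t)}-\sigma_i^1}{k(t)+1}-\mu\left(\pi_i^t-\sigma_i^{k(t)}\right),x\right\rangle-\frac12\|x-\pi_i^t\|^2\right\}.$$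 Noisy feedback: $\widehat\nabla_{\pi_i}v_i(\pi^t)=\nabla_{\pi_i}v_i(\pi^t)+\xi_i^t$ with random noise vectors $\xi_i^t\in\mathbb{R}^{d_i}$. Let $\mathcal{F}_t$ be the sigma-algebra generated by $(\widehat\nabla_{\pi_i}v_i(\pi^1))_{i\in[N]},\dots,(\widehat\nabla_{\pi_i}v_i(\pi^{t-1}))_{i\in[N]}$. Noise assumption: for all $t\ge1$ and $i\in[N]$, (a) $\mathbb{E}[\xi_i^t\mid\mathcal{F}_t]=0$ and (b) $\mathbb{E}[\|\xi_i^t\|^2\mid\mathcal{F}_t]\le C^2$ with some constant $C>0$. *)

(* Defs.v *)
From HB Require Import structures.
From mathcomp Require Import all_boot all_order all_algebra.
From mathcomp Require Import all_classical all_reals all_analysis.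

Set Implicit Arguments.
Unset Strict Implicit.
Unset Printing Implicit Defensive.

Import Order.TTheory GRing.Theory Num.Theory.
Import numFieldNormedType.Exports.

Local Open Scope classical_set_scope.
Local Open Scope ring_scope.

(* The library's norm on row vectors is the sup norm, hence explicit Euclidean
   inner products and norms. *)
Definition dot (R : realType) (n : nat) (x y : 'rV[R]_n) : R :=
  \sum_(j < n) x 0 j * y 0 j.

Definition l2norm (R : realType) (n : nat) (x : 'rV[R]_n) : R :=
  Num.sqrt (dot x x).

Definition profile (R : realType) (N : nat) (dim : 'I_N -> nat) : Type :=
  forall i : 'I_N, 'rV[R]_(dim i).

Section Profiles.
Variables (R : realType) (N : nat) (dim : 'I_N -> nat).
Implicit Types p q : profile R dim.

Definition psub p q : profile R dim := fun i => p i - q i.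

Definition pdot p q : R := \sum_(i < N) dot (p i) (q i).

Definition pnorm p : R := Num.sqrt (pdot p p).

Definition strategy_profiles (X : forall i, set 'rV[R]_(dim i)) :
  set (profile R dim) := [set p | forall i, X i (p i)].

Variable XX : set (profile R dim).

(* Differentiability relative to XX, with gradient g: only the values of f on XX
   matter. When XX has empty interior g is unique only up to vectors normal to
   the affine hull of XX. *)
Definition has_gradient (f : profile R dim -> R) p (g : profile R dim) : Prop :=
  forall e : R, 0 < e -> exists2 delta : R, 0 < delta &
    forall q, XX q -> pnorm (psub q p) <= delta ->
      `|f q - f p - pdot g (psub q p)| <= e * pnorm (psub q p).

Definition is_gradient_operator (v : 'I_N -> profile R dim -> R)
    (V : profile R dim -> profile R dim) : Prop :=
  forall p, XX p -> forall i, exists2 g, has_gradient (v i) p g & V p i = g i.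

Definition monotone_game (V : profile R dim -> profile R dim) : Prop :=
  forall p q, XX p -> XX q -> pdot (psub (V p) (V q)) (psub p q) <= 0.

Definition lipschitz_game (L : R) (V : profile R dim -> profile R dim) : Prop :=
  forall p q, XX p -> XX q ->
    pnorm (psub (V p) (V q)) <= L * pnorm (psub p q).

Definition GAP (V : profile R dim -> profile R dim) p : R :=
  sup [set pdot (V p) (psub q p) | q in XX].

End Profiles.

Definition is_argmax (R : realType) (A : Type) (D : set A) (f : A -> R) (x : A) :
  Prop := D x /\ forall y, D y -> f y <= f x.

(* The epoch number k(t), for t >= 1. *)
Definition epoch (Ts t : nat) : nat := ((t - 1) %/ Ts).+1.

Section Algorithm.
Variables (R : realType) (N : nat) (dim : 'I_N -> nat).

Definition anchor (Ts : nat) (pi : nat -> profile R dim) (k : nat) :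
  profile R dim := pi (Ts * (k - 1) + 1)%N.

(* pi is a GABP trajectory pi 1, ..., pi (T + 1) with feedback fb; the values
   pi 0 and fb 0 are never used. *)
Definition is_GABP (X : forall i, set 'rV[R]_(dim i)) (mu : R) (Ts : nat)
    (eta : nat -> R) (T : nat) (pi1 : profile R dim)
    (fb pi : nat -> profile R dim) : Prop :=
  pi 1%N = pi1 /\
  forall t, (1 <= t <= T)%N -> forall i,
    let k := epoch Ts t in
    let sigma := anchor Ts pi in
    is_argmax (X i)
      (fun x => eta t * dot (fb t i
                             - (mu / (k%:R + 1)) *: (sigma k i - sigma 1%N i)
                             - mu *: (pi t i - sigma k i)) x
                - 2^-1 * l2norm (x - pi t i) ^+ 2)
      (pi t.+1 i).

End Algorithm.

Section Noise.
Variables (d : measure_display) (Omega : measurableType d) (R : realType).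
Variable P : probability Omega R.

(* g is a version of the conditional expectation of f given F. *)
Definition is_cond_expectation (F : set (set Omega)) (f g : Omega -> R) : Prop :=
  [/\ P.-integrable setT (EFin \o f),
      P.-integrable setT (EFin \o g),
      preimage_set_system setT g measurable `<=` F &
      forall A, F A ->
        (\int[P]_(w in A) (f w)%:E = \int[P]_(w in A) (g w)%:E)%E].

Variables (N : nat) (dim : 'I_N -> nat).

(* The sigma-algebra generated by the (coordinates of the) feedback vectors at
   times 1, ..., t - 1. *)
Definition feedback_filtration (fb : nat -> Omega -> profile R dim) (t : nat) :
  set (set Omega) :=
  <<s [set A | exists s i j, (1 <= s < t)%N /\
       preimage_set_system setT (fun w => fb s w i 0 j) measurable A] >>.

Definition noise_assumption (C : R) (T : nat)
    (fb xi : nat -> Omega -> profile R dim) : Prop :=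
  forall t, (1 <= t <= T)%N -> forall i,
    (forall j, is_cond_expectation (feedback_filtration fb t)
                 (fun w => xi t w i 0 j) (cst 0)) /\
    exists2 g : Omega -> R,
      is_cond_expectation (feedback_filtration fb t)
        (fun w => l2norm (xi t w i) ^+ 2) g &
      {ae P, forall w, g w <= C ^+ 2}.

End Noise.

(* Main.v *)
Require Import Defs.
From HB Require Import structures.
From mathcomp Require Import all_boot all_order all_algebra.
From mathcomp Require Import all_classical all_reals all_analysis.
From mathcomp Require Import measurable_realfun ring lra.

Set Implicit Arguments.
Unset Strict Implicit.
Unset Printing Implicit Defensive.

Import Order.TTheory GRing.Theory Num.Theory.
Import numFieldNormedType.Exports.

Local Open Scope classical_set_scope.
Local Open Scope ring_scope.

(* The perturbation of epoch k is a pull of strength mu towards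
   a_k = p_1 + k/(k+1) (sigma_k - p_1), so the exact equilibrium of the perturbed
   game is J a_k with J the (nonexpansive) resolvent of the game, and an
   idealised epoch is one step of Halpern's iteration
   abar_(k+1) = p_1 + (k+1)/(k+2) (J abar_k - p_1), whose residual
   |abar_k - J abar_k| = O(ln k / k) bounds the gap of J abar_k.
   The noisy iterates are compared with the deterministic points J abar_k: strong
   monotonicity makes E |pi - J abar_k|^2 at the end of an epoch exceed
   E |a_k - abar_k|^2 by at most O(ln T / T_sigma), and
   |a_(k+1) - abar_(k+1)| <= |sigma_(k+1) - J abar_k| lets these excesses
   add up over the T / T_sigma ~ T^(1/7) epochs.
   When T is not a multiple of T_sigma the last epoch is truncated, which would be
   harmful if it were short; but T_sigma = c T^(6/7) being an integer forces, for
   fixed c, its length to be at least a fixed fraction of T_sigma. *)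

(** * Euclidean geometry of row vectors *)

Section Euclid.
Variables (R : realType) (n : nat).
Implicit Types (x y z : 'rV[R]_n) (a : R).

Lemma dotC x y : dot x y = dot y x.
Proof. by apply: eq_bigr => j _; rewrite mulrC. Qed.

Lemma dotDl x y z : dot (x + y) z = dot x z + dot y z.
Proof. by rewrite /dot -big_split; apply: eq_bigr => j _; rewrite mxE mulrDl. Qed.

Lemma dotZl a x y : dot (a *: x) y = a * dot x y.
Proof. by rewrite /dot mulr_sumr; apply: eq_bigr => j _; rewrite mxE mulrA. Qed.

Lemma dotNl x y : dot (- x) y = - dot x y.
Proof. by rewrite -scaleN1r dotZl mulN1r. Qed.

Lemma dotDr x y z : dot x (y + z) = dot x y + dot x z.
Proof. by rewrite dotC dotDl !(dotC x). Qed.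

Lemma dotZr a x y : dot x (a *: y) = a * dot x y.
Proof. by rewrite dotC dotZl dotC. Qed.

Lemma dotNr x y : dot x (- y) = - dot x y.
Proof. by rewrite dotC dotNl dotC. Qed.

Definition dotE := (dotDl, dotDr, dotNl, dotNr, dotZl, dotZr).

Lemma dot_ge0 x : 0 <= dot x x.
Proof. by apply: sumr_ge0 => j _; rewrite -expr2 sqr_ge0. Qed.

Lemma dot_eq0 x : dot x x = 0 -> x = 0.
Proof.
move=> /psumr_eq0P h; apply/rowP => j; rewrite mxE.
have /eqP := h (fun j _ => sqr_ge0 (x 0 j)) j isT.
by rewrite mulf_eq0 => /orP[] /eqP.
Qed.

Lemma l2norm_sqr x : l2norm x ^+ 2 = dot x x.
Proof. by rewrite sqr_sqrtr ?dot_ge0. Qed.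

Lemma l2norm_ge0 x : 0 <= l2norm x.
Proof. exact: sqrtr_ge0. Qed.

(** Cauchy-Schwarz: the squared length of [dot y y *: x - dot x y *: y] is [dot y y] times the
    defect of the inequality. *)
Lemma dot_sqr_le x y : dot x y ^+ 2 <= dot x x * dot y y.
Proof.
have [y0|y0] := eqVneq (dot y y) 0.
  by rewrite (dot_eq0 y0) -(scale0r 0) !dotZr !mul0r mulr0 expr0n.
have yp : 0 < dot y y by rewrite lt_neqAle eq_sym y0 dot_ge0.
have := dot_ge0 (dot y y *: x - dot x y *: y).
rewrite !dotE (dotC y x) => h.
have : 0 <= dot y y * (dot x x * dot y y - dot x y ^+ 2).
  by apply: le_trans h _; rewrite le_eqVlt; apply/orP; left; apply/eqP; ring.
by rewrite pmulr_rge0// subr_ge0.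
Qed.

Lemma dot_le x y : dot x y <= l2norm x * l2norm y.
Proof.
apply: le_trans (ler_norm _) _.
by rewrite -sqrtr_sqr -sqrtrM ?dot_ge0// ler_wsqrtr// dot_sqr_le.
Qed.

Lemma l2normD x y : l2norm (x + y) <= l2norm x + l2norm y.
Proof.
rewrite -(@ler_pXn2r _ 2) ?nnegrE ?addr_ge0 ?l2norm_ge0//.
rewrite sqrrD !l2norm_sqr !dotE (dotC y x).
by have := dot_le x y; lra.
Qed.

Lemma l2normZ a x : l2norm (a *: x) = `|a| * l2norm x.
Proof.
by rewrite /l2norm dotZl dotZr mulrA -expr2 sqrtrM ?sqr_ge0// sqrtr_sqr.
Qed.

Lemma l2normN x : l2norm (- x) = l2norm x.
Proof. by rewrite -scaleN1r l2normZ normrN1 mul1r. Qed.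

Lemma l2normBC x y : l2norm (x - y) = l2norm (y - x).
Proof. by rewrite -l2normN opprB. Qed.

Lemma l2norm0 : l2norm (0 : 'rV[R]_n) = 0.
Proof. by rewrite -(scale0r 0) l2normZ normr0 mul0r. Qed.

Lemma l2norm_eq0 x : l2norm x = 0 -> x = 0.
Proof. by move=> h; apply: dot_eq0; rewrite -l2norm_sqr h expr0n. Qed.

Lemma l2norm_tri x y z : l2norm (x - z) <= l2norm (x - y) + l2norm (y - z).
Proof. by rewrite -[x - z](subrKA y) l2normD. Qed.

Lemma l2norm_dist x y : `|l2norm x - l2norm y| <= l2norm (x - y).
Proof.
rewrite ler_norml; have := l2normD (x - y) y; have := l2normD (y - x) x.
by rewrite !subrK (l2normBC y x) => h1 h2; apply/andP; split; lra.
Qed.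

Lemma coord_le_l2norm x j : `|x 0 j| <= l2norm x.
Proof.
rewrite -sqrtr_sqr ler_wsqrtr// /dot (bigD1 j)//= -expr2 lerDl.
by apply: sumr_ge0 => i _; rewrite -expr2 sqr_ge0.
Qed.

Lemma l2norm_le_sum x : l2norm x <= \sum_j `|x 0 j|.
Proof.
rewrite -(@ler_pXn2r _ 2) ?nnegrE ?l2norm_ge0 ?sumr_ge0// l2norm_sqr.
rewrite /dot expr2 mulr_suml ler_sum// => j _.
rewrite (le_trans (ler_norm _))// normrM ler_wpM2l//.
by rewrite (bigD1 j)//= lerDl sumr_ge0.
Qed.

Lemma l2norm_le_norm x : l2norm x <= n%:R * `|x|.
Proof.
apply: le_trans (l2norm_le_sum x) _.
have -> : n%:R * `|x| = \sum_(j < n) `|x|.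
  by rewrite big_const_ord iter_addr_0 mulr_natl.
apply: ler_sum => j _; rewrite /Num.norm/= mx_normrE.
by apply: le_trans (le_bigmax _ _ (ord0, j)).
Qed.

End Euclid.

Section Lipschitz.
Variables (R : realType) (n : nat).

(** Neighbourhoods are balls of the sup norm; [l2norm_le_norm] pays the factor [n] for the change of
    norm. *)
Lemma lipschitz_continuous_rV (K : R) (f : 'rV[R]_n -> R) :
  (forall x y, `|f x - f y| <= K * l2norm (x - y)) -> continuous f.
Proof.
move=> fK x; apply/(@cvgrPdist_le _ _ _ _ (nbhs_filter x)) => e e0.
pose M := `|K| * n%:R + 1.
have M0 : 0 < M by rewrite ltr_wpDl// mulr_ge0.
apply/nbhs_ballP; exists (e / M) => /=; first by rewrite divr_gt0.
move=> y; rewrite mx_norm_ball /ball_/= ltr_pdivlMr// => xy.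
apply: le_trans (fK x y) _; apply: le_trans _ (ltW xy).
apply: (@le_trans _ _ (`|K| * (n%:R * `|x - y|))).
  apply: (@le_trans _ _ (`|K| * l2norm (x - y))).
    by rewrite ler_wpM2r ?l2norm_ge0// ler_norm.
  by rewrite ler_wpM2l// l2norm_le_norm.
by rewrite /M mulrDr mulr1 mulrA (mulrC _ `|x - y|) lerDl.
Qed.

Lemma lipschitz_EVT_min (K : R) (S : set 'rV[R]_n) (f : 'rV[R]_n -> R) :
  compact S -> S !=set0 ->
  (forall x y, `|f x - f y| <= K * l2norm (x - y)) ->
  exists2 c, S c & forall x, S x -> f c <= f x.
Proof.
move=> cS S0 /lipschitz_continuous_rV fc.
have [] := @compact_EVT_min _ _ f S S0 cS.
  exact: continuous_subspaceT.
move=> c; rewrite inE => Sc h; exists c => // x Sx; apply: h; rewrite inE//.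
Qed.

End Lipschitz.

(** * Projections, resolvents and Halpern's iteration *)

Definition convex_rV (R : realType) (n : nat) (S : set 'rV[R]_n) :=
  forall x y t, S x -> S y -> 0 <= t -> t <= 1 -> S (x + t *: (y - x)).

Lemma convex_set_rV (R : realType) (n : nat) (S : set 'rV[R]_n) :
  convex_set S -> convex_rV S.
Proof.
move=> cS x y t Sx Sy t0 t1.
have := cS y x (Itv01 t0 t1); rewrite !inE => /(_ Sy Sx).
rewrite /conv/=; congr S.
by apply/rowP => j; rewrite !mxE ?/unstable.onem; ring.
Qed.

Section Projection.
Variables (R : realType) (n : nat) (S : set 'rV[R]_n).
Hypotheses (cptS : compact S) (cvxS : convex_rV S).

(** The variational form of the nearest point: it is what the estimates use, and it splits over the
    players. *)
Definition is_projection (y z : 'rV[R]_n) :=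
  S z /\ forall x, S x -> dot (y - z) (x - z) <= 0.

(** Moving from [z] towards [x] by a fraction [t] changes the objective by [t * A - t ^+ 2 * B / 2],
    so a positive [A] would permit an improvement. *)
Lemma argmax_is_projection (g y z : 'rV[R]_n) :
  S z ->
  (forall x, S x -> dot g x - 2^-1 * l2norm (x - y) ^+ 2
                    <= dot g z - 2^-1 * l2norm (z - y) ^+ 2) ->
  is_projection (y + g) z.
Proof.
move=> Sz zmax; split=> // x Sx.
set A := dot _ _; pose B := dot (x - z) (x - z).
rewrite leNgt; apply/negP => A0.
have B0 : 0 <= B by exact: dot_ge0.
have AB : 0 < A + B by lra.
(* This fraction satisfies [t * B <= A] even when [B = 0], so the gain is at least [t * A / 2]. *)
pose t := A / (A + B).
have t0 : 0 < t by rewrite divr_gt0.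
have t1 : t <= 1 by rewrite ler_pdivrMr// mul1r; lra.
have := zmax _ (cvxS Sz Sx (ltW t0) t1).
have tAB : t * (A + B) = A by rewrite mulfVK// gt_eqF.
have -> : dot g (z + t *: (x - z)) - 2^-1 * l2norm (z + t *: (x - z) - y) ^+ 2
   = dot g z - 2^-1 * l2norm (z - y) ^+ 2 + t * A - 2^-1 * t ^+ 2 * B.
  rewrite !l2norm_sqr /A /B !dotE.
  by rewrite (dotC z y) (dotC x y) (dotC x z); field.
move=> h; have : t * (A - 2^-1 * (t * B)) <= 0 by rewrite expr2 in h; lra.
rewrite pmulr_rle0// => h1.
have : t * B <= A by rewrite -tAB ler_wpM2l ?(ltW t0)//; lra.
lra.
Qed.

Lemma projection_exists (y : 'rV[R]_n) : S !=set0 -> exists z, is_projection y z.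
Proof.
move=> S0.
have [|z Sz zmin] := @lipschitz_EVT_min R n 1 S (fun x => l2norm (x - y)) cptS S0.
  by move=> a b; rewrite mul1r (le_trans (l2norm_dist _ _))// opprB addrA subrK.
exists z; rewrite -[y]addr0; apply: argmax_is_projection => // x Sx.
rewrite -(scale0r 0) !dotZl !mul0r !sub0r lerN2 ler_wpM2l ?invr_ge0//.
by rewrite ler_pXn2r ?nnegrE ?l2norm_ge0// zmin.
Qed.

(** Adding the two variational inequalities gives [|z - z'|^2 <= <y - y', z - z'>]. *)
Lemma projection_nonexpansive y y' z z' :
  is_projection y z -> is_projection y' z' -> l2norm (z - z') <= l2norm (y - y').
Proof.
move=> [Sz hz] [Sz' hz'].
have h : l2norm (z - z') ^+ 2 <= l2norm (y - y') * l2norm (z - z').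
  apply: le_trans _ (dot_le _ _); rewrite l2norm_sqr.
  have := hz _ Sz'; have := hz' _ Sz; rewrite !dotE (dotC z' z); lra.
have := l2norm_ge0 (z - z'); rewrite le_eqVlt => /orP[/eqP <-|z0].
  exact: l2norm_ge0.
by rewrite -(ler_pM2r z0) -expr2.
Qed.

Lemma projection_uniq y z z' : is_projection y z -> is_projection y z' -> z = z'.
Proof.
move=> h h'; apply/subr0_eq/l2norm_eq0/le_anti; rewrite l2norm_ge0 andbT.
by have := projection_nonexpansive h h'; rewrite subrr l2norm0.
Qed.

Lemma projection_id y : S y -> is_projection y y.
Proof.
by move=> Sy; split=> // x Sx; rewrite subrr -(scale0r 0) dotZl mul0r.
Qed.

End Projection.

Section Resolvent.
Variables (R : realType) (n : nat) (S : set 'rV[R]_n).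
Hypotheses (cptS : compact S) (cvxS : convex_rV S).
Variables (W : 'rV[R]_n -> 'rV[R]_n) (L mu : R).
Hypotheses (L0 : 0 < L) (mu0 : 0 < mu).
Hypothesis Wmono : forall x y, S x -> S y -> dot (W x - W y) (x - y) <= 0.
Hypothesis Wlip :
  forall x y, S x -> S y -> l2norm (W x - W y) <= L * l2norm (x - y).

(** In operator terms [p = (I + (N_S - W) / mu)^-1 a], with [N_S] the normal cone of [S]. *)
Definition is_resolvent (a p : 'rV[R]_n) :=
  S p /\ forall x, S x -> dot (W p - mu *: (p - a)) (x - p) <= 0.

(* A minimiser of [|F p - p|] over the compact set S is a fixed point of the
   contraction F, a projected gradient step of the regularised game. *)
Lemma resolvent_exists a : S !=set0 -> exists p, is_resolvent a p.
Proof.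
move=> S0.
have [Pj PjP] := choice (fun y => projection_exists cptS cvxS y S0).
pose Q := mu ^+ 2 + L ^+ 2.
have Q0 : 0 < Q by rewrite addr_gt0 ?exprn_gt0.
(* With this step size [rho ^+ 2 + s ^+ 2 * L ^+ 2 = rho], so [u] contracts squared distances in [S]
   by [rho < 1]. *)
pose s := mu / Q.
have s0 : 0 < s by rewrite divr_gt0.
pose u p := p + s *: (W p - mu *: (p - a)).
pose rho := 1 - mu * s.
have rho1 : rho < 1 by rewrite /rho ltrBlDr ltrDl mulr_gt0.
have smu : 0 <= rho.
  rewrite /rho subr_ge0 /s mulrA -expr2 ler_pdivrMr// mul1r /Q lerDl.
  exact: sqr_ge0.
have ulip x y : S x -> S y ->
    l2norm (u x - u y) ^+ 2 <= rho * l2norm (x - y) ^+ 2.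
  move=> Sx Sy.
  have -> : u x - u y = rho *: (x - y) + s *: (W x - W y).
    by apply/rowP => j; rewrite !mxE /rho; ring.
  have h1 := Wmono Sx Sy.
  have h2 : l2norm (W x - W y) ^+ 2 <= L ^+ 2 * l2norm (x - y) ^+ 2.
    by rewrite -exprMn ler_pXn2r ?nnegrE ?mulr_ge0 ?l2norm_ge0 ?(ltW L0)// Wlip.
  rewrite !l2norm_sqr in h2 *.
  move: (x - y) (W x - W y) h1 h2 => d e h1 h2.
  rewrite !dotE (dotC d e).
  have h3 : 0 <= rho * s * - dot e d.
    apply: mulr_ge0; last by rewrite oppr_ge0.
    exact: (mulr_ge0 smu (ltW s0)).
  have h4 : s ^+ 2 * dot e e <= s ^+ 2 * (L ^+ 2 * dot d d).
    by rewrite ler_wpM2l// sqr_ge0.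
  have sQ : s * Q = mu by rewrite mulfVK// gt_eqF.
  have h5 : s ^+ 2 * (L ^+ 2 * dot d d) = (rho - rho ^+ 2) * dot d d.
    rewrite (_ : rho - rho ^+ 2 = mu * s - s ^+ 2 * mu ^+ 2) ?/rho; last by ring.
    rewrite -[in mu * s]sQ /Q; ring.
  by rewrite h5 in h4; lra.
(* The inner projection makes [F] nonexpansive on the whole space, although [W] is controlled on [S]
   alone. *)
pose F p := Pj (u (Pj p)).
have FP x y : l2norm (F x - F y) <= l2norm (u (Pj x) - u (Pj y)).
  exact: projection_nonexpansive (PjP _) (PjP _).
have F1 x y : l2norm (F x - F y) <= l2norm (x - y).
  rewrite -(@ler_pXn2r _ 2) ?nnegrE ?l2norm_ge0//.
  apply: (@le_trans _ _ (l2norm (u (Pj x) - u (Pj y)) ^+ 2)).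
    by rewrite ler_pXn2r ?nnegrE ?l2norm_ge0.
  apply: le_trans (ulip _ _ (PjP x).1 (PjP y).1) _.
  apply: (@le_trans _ _ (l2norm (Pj x - Pj y) ^+ 2)).
    by rewrite ler_piMl ?exprn_ge0 ?l2norm_ge0// ltW.
  rewrite ler_pXn2r ?nnegrE ?l2norm_ge0//.
  exact: projection_nonexpansive (PjP _) (PjP _).
have [|c Sc cmin] := @lipschitz_EVT_min R n 2 S (fun x => l2norm (F x - x)) cptS S0.
  move=> x y; apply: le_trans (l2norm_dist _ _) _.
  have -> : F x - x - (F y - y) = (F x - F y) + (y - x).
    by apply/rowP => j; rewrite !mxE; ring.
  apply: le_trans (l2normD _ _) _; rewrite (l2normBC y).
  by have := F1 x y; lra.
have PjS x : S x -> Pj x = x.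
  by move=> Sx; apply: projection_uniq (PjP x) (projection_id Sx).
have SF x : S (F x) by exact: (PjP _).1.
(* Applying [F] once more shrinks the squared displacement by [rho], against the minimality of [c]
   unless the displacement is 0. *)
have Fc : F c = c.
  have h : l2norm (F (F c) - F c) ^+ 2 <= rho * l2norm (F c - c) ^+ 2.
    apply: (@le_trans _ _ (l2norm (u (F c) - u c) ^+ 2)); last exact: ulip.
    rewrite ler_pXn2r ?nnegrE ?l2norm_ge0//.
    by have := FP (F c) c; rewrite !PjS.
  have h1 : l2norm (F c - c) ^+ 2 <= l2norm (F (F c) - F c) ^+ 2.
    by rewrite ler_pXn2r ?nnegrE ?l2norm_ge0// cmin.
  apply/subr0_eq/l2norm_eq0/eqP; rewrite -sqrf_eq0; apply/negPn/negP => h2.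
  have h3 : 0 < l2norm (F c - c) ^+ 2 by rewrite lt_neqAle eq_sym h2 sqr_ge0.
  have h4 : 0 < (1 - rho) * l2norm (F c - c) ^+ 2 by rewrite mulr_gt0// subr_gt0.
  by have := le_trans h1 h; lra.
exists c; split=> // x Sx.
have := (PjP (u c)).2 x Sx; rewrite (_ : Pj (u c) = c); last first.
  by have := Fc; rewrite /F (PjS c).
rewrite (_ : u c - c = s *: (W c - mu *: (c - a))); last by rewrite [u c]addrC addrK.
by rewrite dotZl pmulr_rle0.
Qed.

(** In the sum of the two variational inequalities monotonicity removes the [W] terms and leaves
    [|p - p'|^2 <= <a - a', p - p'>]. *)
Lemma resolvent_nonexpansive a a' p p' :
  is_resolvent a p -> is_resolvent a' p' -> l2norm (p - p') <= l2norm (a - a').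
Proof.
move=> [Sp hp] [Sp' hp'].
have h : l2norm (p - p') ^+ 2 <= l2norm (a - a') * l2norm (p - p').
  apply: le_trans _ (dot_le _ _); rewrite l2norm_sqr -(ler_pM2l mu0).
  have := hp _ Sp'; have := hp' _ Sp; have := Wmono Sp Sp'.
  rewrite !dotE (dotC p' p); lra.
have := l2norm_ge0 (p - p'); rewrite le_eqVlt => /orP[/eqP <-|z0].
  exact: l2norm_ge0.
by rewrite -(ler_pM2r z0) -expr2.
Qed.

End Resolvent.

Lemma invS_le_ln (R : realType) (n : nat) :
  (0 < n)%N -> n.+1%:R^-1 <= ln n.+1%:R - ln n%:R :> R.
Proof.
move=> n0; have n1 : (0 : R) < n.+1%:R by rewrite ltr0n.
rewrite -lerN2 opprB -ln_div ?posrE ?ltr0n//.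
have -> : n%:R / n.+1%:R = 1 + - n.+1%:R^-1 :> R.
  by rewrite -natr1; field; rewrite natr1 gt_eqF.
by apply: le_ln1Dx; rewrite ltrN2 invf_lt1// ltr1n ltnS.
Qed.

Section Halpern.
Variables (R : realType) (n : nat) (S : set 'rV[R]_n) (J : 'rV[R]_n -> 'rV[R]_n).
Variables (s : 'rV[R]_n) (D : R).

(* [halpern k] is the (k+1)-st iterate of the paper's indexing. *)
Fixpoint halpern (k : nat) : 'rV[R]_n :=
  if k is k'.+1 then s + (k.+1%:R / k.+2%:R) *: (J (halpern k') - s) else s.

Hypothesis SJ : forall x, S (J x).
Hypothesis J1 : forall x y, l2norm (J x - J y) <= l2norm (x - y).
Hypothesis Ss : S s.
Hypothesis SD : forall x y, S x -> S y -> l2norm (x - y) <= D.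

(** Nonexpansiveness carries the weighted increment over unchanged, and the change of the Halpern
    coefficient adds at most [D / k.+3]; the harmonic sum gives the logarithm. *)
Lemma halpern_step k :
  k.+3%:R * l2norm (halpern k.+1 - halpern k) <= D * (3 + ln k.+1%:R).
Proof.
have D0 : 0 <= D by have := SD Ss Ss; rewrite subrr l2norm0.
elim: k => [|k IH].
  rewrite ln1 addr0 /= [s + _]addrC addrK l2normZ ger0_norm; last first.
    by rewrite divr_ge0.
  rewrite mulrA [_ * (_ / _)]mulrC mulfVK ?pnatr_eq0// mulrC ler_pM ?l2norm_ge0//.
    exact: SD.
  by rewrite ler_nat.
set x := halpern k.+1 in IH *.
have -> : halpern k.+2 - x = (k.+3%:R / k.+4%:R) *: (J x - J (halpern k))
    + (k.+3%:R / k.+4%:R - k.+2%:R / k.+3%:R) *: (J (halpern k) - s).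
  rewrite [halpern k.+2]/= -/x [in X in _ - X]/x [halpern k.+1]/=.
  by apply/rowP => j; rewrite !mxE; ring.
have k3 : (0 : R) < k.+3%:R by rewrite ltr0n.
have k4 : (0 : R) < k.+4%:R by rewrite ltr0n.
apply: (@le_trans _ _ (k.+3%:R * l2norm (J x - J (halpern k))
                       + k.+3%:R^-1 * l2norm (J (halpern k) - s))).
  rewrite -ler_pdivlMl// mulrDr !mulrA; apply: le_trans (l2normD _ _) _.
  rewrite !l2normZ ger0_norm ?divr_ge0//.
  have -> : k.+3%:R / k.+4%:R - k.+2%:R / k.+3%:R = k.+4%:R^-1 / k.+3%:R :> R.
    by rewrite -!natr1; field; rewrite !natr1 !gt_eqF.
  by rewrite ger0_norm ?mulr_ge0 ?invr_ge0// (mulrC k.+3%:R).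
(* Relaxing [k.+3%:R^-1] to [k.+2%:R^-1] matches the increment of the logarithm in [invS_le_ln]. *)
apply: (@le_trans _ _ (D * (3 + ln k.+1%:R) + k.+2%:R^-1 * D)).
  apply: lerD; first by apply: le_trans IH; rewrite ler_wpM2l// J1.
  by rewrite ler_pM ?invr_ge0 ?l2norm_ge0 ?SD// lef_pV2 ?posrE ?ltr0n// ler_nat.
rewrite [_ * D]mulrC -mulrDr ler_wpM2l//.
by rewrite -addrA lerD2l -lerBrDl invS_le_ln.
Qed.

(** Pass through [halpern k.+1]: its distance to [J (halpern k)] is [|s - J (halpern k)| / k.+3]. *)
Lemma halpern_residual k :
  k.+3%:R * l2norm (halpern k - J (halpern k)) <= D * (4 + ln k.+1%:R).
Proof.
apply: (@le_trans _ _ (k.+3%:R * (l2norm (halpern k.+1 - halpern k)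
   + l2norm (halpern k.+1 - J (halpern k))))).
  by rewrite ler_wpM2l// (l2normBC (halpern k.+1)) l2norm_tri.
rewrite mulrDr (_ : D * (4 + _) = D * (3 + ln k.+1%:R) + D); last by ring.
rewrite lerD ?halpern_step//=.
set y := J _; have -> : s + (k.+2%:R / k.+3%:R) *: (y - s) - y
   = k.+3%:R^-1 *: (s - y).
  by apply/rowP => j; rewrite !mxE -!natr1; field; rewrite !natr1 pnatr_eq0.
rewrite l2normZ ger0_norm ?invr_ge0// mulrA mulfV ?pnatr_eq0// mul1r.
exact: (SD Ss (SJ _)).
Qed.

End Halpern.

(** * Measurability and conditionally centred noise *)

(** A sublevel set of [f \o y] is a countable union of rational boxes on which the Lipschitz bound
    already forces [f] below the level. *)
Lemma measurable_lipschitz (R : realType) (n : nat) d (T : measurableType d)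
    (y : T -> 'rV[R]_n) (f : 'rV[R]_n -> R) (K : R) :
  (forall j, measurable_fun setT (fun w => y w 0 j)) ->
  (forall a b, `|f a - f b| <= K * l2norm (a - b)) ->
  measurable_fun setT (fun w => f (y w)).
Proof.
move=> my fK0.
pose M := `|K|.
have M0 : 0 <= M by exact: normr_ge0.
have fK a b : `|f a - f b| <= M * \sum_j `|a 0 j - b 0 j|.
  apply: le_trans (fK0 a b) _.
  apply: (@le_trans _ _ (M * l2norm (a - b))).
    by rewrite ler_wpM2r ?l2norm_ge0// ler_norm.
  rewrite ler_wpM2l// (le_trans (l2norm_le_sum _))// le_eqVlt.
  by apply/orP; left; apply/eqP; apply: eq_bigr => j _; rewrite !mxE.
apply: (measurability _ (RGenInftyO.measurableE R)) => //.
move=> _ [_ [a ->] <-]; rewrite setTI.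
pose q (u : {ffun 'I_n -> rat}) : 'rV[R]_n := \row_j ratr (u j).
pose box (u : {ffun 'I_n -> rat} * rat) : set T :=
  if f (q u.1) + M * (n%:R * ratr u.2) < a
  then \bigcap_j [set w | `|y w 0 j - q u.1 0 j| < ratr u.2] else set0.
have sum_lt (x z : 'rV[R]_n) (r : R) : (forall j, `|x 0 j - z 0 j| < r) ->
    M * \sum_(j < n) `|x 0 j - z 0 j| <= M * (n%:R * r).
  move=> h; rewrite ler_wpM2l//.
  have -> : n%:R * r = \sum_(j < n) r by rewrite big_const_ord iter_addr_0 mulr_natl.
  by apply: ler_sum => j _; exact: ltW.
rewrite (_ : _ @^-1` _ = \bigcup_u box u); last first.
  apply/seteqP; split => w /=.
    rewrite in_itv/= => fa.
    (* A box radius [r < g] costs [M * n * r] twice, at the centre and across the box, and the sum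
       stays below [a]. *)
    pose g := (a - f (y w)) / (2 * M * n%:R + 1).
    have c0 : 0 < 2 * M * n%:R + 1 by rewrite ltr_wpDl ?mulr_ge0.
    have g0 : 0 < g by rewrite divr_gt0// subr_gt0.
    have [r] := rat_in_itvoo g0; rewrite in_itv/= => /andP[r0 rg].
    have hq j : exists p : rat, `|y w 0 j - ratr p| < ratr r.
      have [p] : exists p : rat, ratr p \in `]y w 0 j - ratr r, y w 0 j + ratr r[%R.
        by apply: rat_in_itvoo; rewrite ltrD2l gtrN.
      by rewrite in_itv/= -ltr_distlC => ?; exists p.
    have [u hu] := choice hq.
    have hu' j : `|y w 0 j - q [ffun j => u j] 0 j| < ratr r.
      by rewrite mxE ffunE.
    exists ([ffun j => u j], r) => //; rewrite /box/= ifT; first by move=> j _; exact: hu'.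
    have := fK (q [ffun j => u j]) (y w); rewrite ler_norml => /andP[_ h].
    have h1 := sum_lt (q [ffun j => u j]) (y w) (ratr r).
    have /h1 h2 : forall j, `|q [ffun j => u j] 0 j - y w 0 j| < ratr r.
      by move=> j; rewrite distrC.
    rewrite /g ltr_pdivlMr// in rg; lra.
  move=> [u _]; rewrite /box; case: ifPn => // fq /= hw.
  rewrite in_itv/=.
  have := fK (y w) (q u.1); rewrite ler_norml => /andP[_ h].
  have := sum_lt (y w) (q u.1) _ (fun j => hw j I); lra.
apply: countable_bigcupT_measurable; first exact: countableP.
move=> u; rewrite /box; case: ifPn => // _.
rewrite -[X in measurable X]setCK setC_bigcap; apply: measurableC.
apply: countable_bigcupT_measurable; first exact: countableP.
move=> j; apply: measurableC.
have -> : [set w | `|y w 0 j - q u.1 0 j| < ratr u.2] =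
    setT `&` (fun w => `|y w 0 j - q u.1 0 j|) @^-1` `]-oo, ratr u.2[%classic.
  by rewrite setTI; apply/seteqP; split => w /=; rewrite in_itv.
have m : measurable_fun setT (fun w => `|y w 0 j - q u.1 0 j|).
  by apply: measurableT_comp => //; apply: measurable_funB.
exact: (m measurableT).
Qed.

(** * Expectations against conditionally centred noise *)

Section Pullout.
Variables (d : measure_display) (Omega : measurableType d) (R : realType).
Variable P : probability Omega R.
Implicit Types f g X Y : Omega -> R.

Local Notation integ f := (P.-integrable setT (EFin \o f)).
Local Notation Ex f := (Rintegral P setT f).

Lemma integrable_bounded f (b : R) : measurable_fun setT f ->
  (forall w, `|f w| <= b) -> integ f.
Proof.
move=> mf fb; apply: measurable_bounded_integrable => //.
  exact: (le_lt_trans (probability_le1 P measurableT) (ltry _)).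
exists b; split; first exact: num_real.
by move=> x bx w _ /=; apply: le_trans (fb w) (ltW bx).
Qed.

Lemma integrable_bounded_mul X Y (b : R) : integ X -> measurable_fun setT Y ->
  (forall w, `|Y w| <= b) -> integ (fun w => X w * Y w).
Proof.
move=> iX mY Yb.
have := @integrableMl _ _ _ P setT measurableT (EFin \o X) Y iX mY; apply.
exists b; split; first exact: num_real.
by move=> x bx w _ /=; apply: le_trans (Yb w) (ltW bx).
Qed.

Lemma ExD f g : integ f -> integ g -> Ex (fun w => f w + g w) = Ex f + Ex g.
Proof. exact: RintegralD. Qed.

Lemma ExZ (r : R) f : integ f -> Ex (fun w => r * f w) = r * Ex f.
Proof. exact: RintegralZl. Qed.

Lemma integD f g : integ f -> integ g -> integ (fun w => f w + g w).
Proof. by move=> hf hg; have := integrableD measurableT hf hg. Qed.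

Lemma integZ (r : R) f : integ f -> integ (fun w => r * f w).
Proof. by move=> hf; have := integrableZl measurableT r hf. Qed.

Lemma integ_cst (r : R) : integ (fun=> r).
Proof. exact: (@integrable_bounded _ `|r|). Qed.

Lemma Ex_cst (r : R) : Ex (fun=> r) = r.
Proof.
rewrite Rintegral_cst// (_ : fine _ = 1) ?mulr1//.
by have := @probability_setT _ _ _ P => /= ->.
Qed.

Lemma le_Ex f g : integ f -> integ g -> (forall w, f w <= g w) -> Ex f <= Ex g.
Proof. by move=> hf hg fg; apply: le_Rintegral. Qed.

Lemma integ_sum (I : Type) (s : seq I) (F : I -> Omega -> R) :
  (forall i, integ (F i)) -> integ (fun w => \sum_(i <- s) F i w).
Proof.
move=> hF; elim: s => [|i s IH].
  by under eq_fun do rewrite big_nil; exact: integ_cst.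
by under eq_fun do rewrite big_cons; exact: integD.
Qed.

Lemma Ex_sum (I : Type) (s : seq I) (F : I -> Omega -> R) :
  (forall i, integ (F i)) ->
  Ex (fun w => \sum_(i <- s) F i w) = \sum_(i <- s) Ex (F i).
Proof.
move=> hF; elim: s => [|i s IH].
  by under eq_fun do rewrite big_nil; rewrite big_nil Ex_cst.
under eq_fun do rewrite big_cons.
by rewrite big_cons ExD ?IH//; exact: integ_sum.
Qed.

Variable G : set (set Omega).
Hypothesis Gmeas : <<s G >> `<=` measurable.
Variable X : Omega -> R.
Hypothesis iX : integ X.
Hypothesis X0 : forall A, <<s G >> A ->
  (\int[P]_(w in A) (X w)%:E = \int[P]_(w in A) (cst 0 w)%:E)%E.

Let Ex_indic A : <<s G >> A -> Ex (fun w => X w * \1_A w) = 0.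
Proof.
move=> GA; have -> : Ex (fun w => X w * \1_A w) = \int[P]_(w in A) X w.
  rewrite [RHS]Rintegral_mkcond; apply: eq_Rintegral => w _ /=.
  by rewrite patchE indicE; case: ifP; rewrite ?mulr1 ?mulr0.
rewrite /Rintegral X0// integral0_eq//.
Qed.

Lemma measurable_fun_sub (Y : Omega -> R) :
  measurable_fun (setT : set (g_sigma_algebraType G)) Y ->
  measurable_fun (setT : set Omega) Y.
Proof. by move=> mY _ B mB; apply: Gmeas; exact: (mY measurableT). Qed.

(* Subtracting [b/2] on [{Y >= b/2}] halves the range of Y without changing
   the expectation of the product. *)
Let Ex_mul_halving n (Y : Omega -> R) (b : R) :
  measurable_fun (setT : set (g_sigma_algebraType G)) Y ->
  (forall w, 0 <= Y w <= b) ->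
  2 ^+ n * `|Ex (fun w => X w * Y w)| <= b * Ex (fun w => `|X w|).
Proof.
elim: n Y b => [|n IH] Y b mY Yb.
  have Y_le w : `|Y w| <= b by have /andP[? ?] := Yb w; rewrite ger0_norm.
  have iXY := integrable_bounded_mul iX (measurable_fun_sub mY) Y_le.
  have iaX : integ (fun w => `|X w|) by exact: integrable_norm.
  rewrite expr0 mul1r -ExZ//; apply: le_trans (le_normr_Rintegral _ _) _ => //.
  apply: le_Ex; [exact: integrable_norm iXY|exact: integZ|move=> w].
  by rewrite normrM mulrC ler_wpM2r.
pose A := [set w | b / 2 <= Y w].
have mA : <<s G >> A.
  have -> : A = setT `&` Y @^-1` `[b / 2, +oo[%classic.
    by rewrite setTI; apply/seteqP; split => w /=; rewrite in_itv/= andbT.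
  exact: (mY measurableT _ (measurable_itv _)).
pose Z w := Y w - b / 2 * \1_A w.
have mZ : measurable_fun (setT : set (g_sigma_algebraType G)) Z.
  apply: measurable_funB => //; apply: measurable_funM => //.
have Zb w : 0 <= Z w <= b / 2.
  have /andP[h1 h2] := Yb w; rewrite /Z indicE.
  case: (boolP (w \in A)) => [/set_mem|/negP]; rewrite ?mulr1 ?mulr0.
    by rewrite /A/= => ?; apply/andP; split; lra.
  move=> h; have /negP : ~ (b / 2 <= Y w) by move=> ?; apply: h; rewrite inE.
  by rewrite -ltNge => ?; apply/andP; split; lra.
have Z_le w : `|Z w| <= b / 2 by have /andP[? ?] := Zb w; rewrite ger0_norm.
have A_le w : `|\1_A w : R| <= 1 by rewrite indicE; case: (_ \in _); rewrite ?normr1 ?normr0.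
have iXZ := integrable_bounded_mul iX (measurable_fun_sub mZ) Z_le.
have iXA : integ (fun w => X w * \1_A w).
  apply: (@integrable_bounded_mul _ _ 1) => //.
  by apply/measurable_indicP; exact: Gmeas.
have -> : Ex (fun w => X w * Y w) = Ex (fun w => X w * Z w).
  rewrite (_ : (fun w => X w * Y w) =
    fun w => X w * Z w + b / 2 * (X w * \1_A w)); last first.
    by apply/funext => w; rewrite /Z; ring.
  by rewrite ExD ?ExZ ?Ex_indic ?mulr0 ?addr0//; exact: integZ.
have := IH Z (b / 2) mZ Zb; rewrite exprS; lra.
Qed.

(** Shifting [Y] by [b] is free since [X] has mean zero, and makes the range [[0, 2 b]]; halving
    then bounds the expectation by [2^-n] times a constant for every [n]. *)
Lemma Ex_mul_eq0 (Y : Omega -> R) (b : R) :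
  measurable_fun (setT : set (g_sigma_algebraType G)) Y ->
  (forall w, `|Y w| <= b) -> Ex (fun w => X w * Y w) = 0.
Proof.
move=> mY Yb.
have EX0 : Ex X = 0.
  rewrite /Rintegral X0 ?integral0_eq//.
  exact: (@measurableT _ (g_sigma_algebraType G)).
pose Z w := Y w + b.
have mZ : measurable_fun (setT : set (g_sigma_algebraType G)) Z.
  exact: measurable_funD.
have Zb w : 0 <= Z w <= 2 * b.
  by have := Yb w; rewrite /Z ler_norml => /andP[? ?]; apply/andP; split; lra.
have iXY := integrable_bounded_mul iX (measurable_fun_sub mY) Yb.
have -> : Ex (fun w => X w * Y w) = Ex (fun w => X w * Z w).
  rewrite (_ : (fun w => X w * Z w) = fun w => X w * Y w + b * X w); last first.
    by apply/funext => w; rewrite /Z; ring.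
  by rewrite ExD ?ExZ ?EX0 ?mulr0 ?addr0//; exact: integZ.
apply/eqP; rewrite -normr_eq0; apply/negPn/negP => h.
have h0 : 0 < `|Ex (fun w => X w * Z w)| by rewrite lt_neqAle eq_sym h normr_ge0.
set e := `|_| in h0; set M := 2 * b * Ex (fun w => `|X w|).
have bd n : 2 ^+ n * e <= M := @Ex_mul_halving n Z (2 * b) mZ Zb.
pose n := Num.bound (M / e).
have M0 : 0 <= M / e.
  by rewrite divr_ge0 ?(ltW h0)//; apply: le_trans (bd 0%N); rewrite mul1r ltW.
have := archi_boundP M0; rewrite ltr_pdivrMr// -/n => hn.
have : n%:R * e <= 2 ^+ n * e.
  by rewrite ler_wpM2r ?(ltW h0)// -natrX ler_nat ltnW// ltn_expl.
by move=> /le_trans /(_ (bd n)); rewrite leNgt hn.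
Qed.

End Pullout.

(** * One step and one epoch of the dynamics *)

Section Step.
Variables (R : realType) (n : nat) (S : set 'rV[R]_n).
Variables (W : 'rV[R]_n -> 'rV[R]_n) (mu zeta D : R).
Hypothesis Wmono : forall x y, S x -> S y -> dot (W x - W y) (x - y) <= 0.
Hypothesis mu0 : 0 < mu.

(* The comparator [q] solves the game anchored at [abar], not the one anchored
   at [a] that drives the step, so that it can be taken deterministic. *)
Lemma perturbed_step (x x' a abar q xi : 'rV[R]_n) (eta : R) :
  0 < eta -> S x -> is_resolvent S W mu abar q ->
  is_projection S (x + eta *: (W x + xi - mu *: (x - a))) x' ->
  l2norm (W x) <= zeta -> l2norm (x - a) <= D ->
  l2norm (x' - q) ^+ 2 <=
    (1 - eta * mu) * l2norm (x - q) ^+ 2 + eta * mu * l2norm (a - abar) ^+ 2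
    + 2 * eta ^+ 2 * ((zeta + mu * D) ^+ 2 + l2norm xi ^+ 2)
    + 2 * eta * dot xi (x - q).
Proof.
move=> eta0 Sx [Sq hq] [Sx' hx'] Wx xa.
have h1 := hx' _ Sq; have h2 := hq _ Sx; have h3 := Wmono Sx Sq.
set GG := W x - mu *: (x - a).
have hG : dot GG GG <= (zeta + mu * D) ^+ 2.
  have z0 : 0 <= zeta by apply: le_trans Wx; exact: l2norm_ge0.
  have D0 : 0 <= D by apply: le_trans xa; exact: l2norm_ge0.
  rewrite -l2norm_sqr ler_pXn2r ?nnegrE ?l2norm_ge0 ?addr_ge0 ?mulr_ge0 ?(ltW mu0)//.
  apply: le_trans (l2normD _ _) _; rewrite l2normN l2normZ gtr0_norm//.
  by rewrite lerD// ler_wpM2l// ltW.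
pose u := x - q; pose v := x' - x; pose b := a - abar.
pose A := W x - W q; pose B := W q - mu *: (q - abar).
(* Monotonicity handles [A], the variational inequality of [q] handles [B], [- mu *: u] contracts,
   and [mu *: b] is the price of the wrong anchor. *)
have EG : GG = A + B - mu *: u + mu *: b.
  by apply/rowP => j; rewrite /GG /A /B /u /b !mxE; ring.
have Exq : x' - q = u + v by apply/rowP => j; rewrite /u /v !mxE; ring.
have E1 : dot (x + eta *: (W x + xi - mu *: (x - a)) - x') (q - x') =
    dot (v - eta *: (GG + xi)) (u + v).
  rewrite -[LHS]opprK -dotNl -dotNr /v /u /GG; congr dot;
    by apply/rowP => j; rewrite !mxE; ring.
rewrite E1 in h1; rewrite -/u -/A -/B in h2 h3.
rewrite Exq -/u -/b !l2norm_sqr.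
(* Three Young inequalities: [h4] absorbs the cross term with the displacement [v], [h5] separates
   [GG] from the noise, [h6] splits [dot b u] and spends half of the contraction. *)
have h4 := dot_ge0 (v - eta *: (GG + xi)).
have h5 := dot_ge0 (GG - xi).
have h6 := dot_ge0 (b - u).
have h7 : dot GG u = dot A u + dot B u - mu * dot u u + mu * dot b u.
  by rewrite EG; move: (A) (B) (u) (b) => *; rewrite !dotE.
move: h1 h2 h3 h4 h5 h6 h7 hG {E1 Exq EG Wx xa hx' hq}.
move: GG u v b A B => G u v b A B.
rewrite !dotE (dotC u v) (dotC v G) (dotC v xi) (dotC u b) (dotC xi G) => h1 h2 h3 h4 h5 h6 h7 hG.
have k1 : dot G u <= - mu * dot u u + mu * (2^-1 * (dot b b + dot u u)).
  have : mu * dot b u <= mu * (2^-1 * (dot b b + dot u u)).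
    by rewrite ler_wpM2l ?(ltW mu0)//; lra.
  by rewrite h7; lra.
have k2 := ler_wpM2l (ltW eta0) k1.
have k3 : eta ^+ 2 * (dot G G + 2 * dot G xi + dot xi xi) <=
   eta ^+ 2 * (2 * ((zeta + mu * D) ^+ 2 + dot xi xi)).
  by rewrite ler_wpM2l ?sqr_ge0//; lra.
have -> : dot u u + dot v u + (dot v u + dot v v) = dot u u + dot v v + 2 * dot v u.
  by ring.
lra.
Qed.

End Step.

Definition harmonic_sum (R : realType) (n : nat) : R := \sum_(i < n) i.+1%:R^-1.

Lemma harmonic_sum_le (R : realType) (n : nat) :
  (0 < n)%N -> harmonic_sum R n <= 1 + ln n%:R.
Proof.
case: n => // n _; elim: n => [|n IH].
  by rewrite /harmonic_sum big_ord1 ln1 addr0 invr1.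
rewrite /harmonic_sum big_ord_recr/= -/(harmonic_sum _ _).
have := @invS_le_ln R n.+1 isT; move: IH.
by move: (harmonic_sum _ _) (ln _) (ln _) (_^-1) => a b c e; lra.
Qed.

(* Multiplying by [kappa i + th] telescopes the recursion for the excess of
   [D] over [e]; the excess may be negative. *)
Lemma sgd_recursion (R : realType) (kappa th B e D2 : R) (D : nat -> R) (n : nat) :
  0 < kappa -> kappa <= th -> 0 <= B -> 0 <= e -> 0 <= D2 -> D 0%N <= D2 ->
  (forall i, (i < n)%N -> let eta := (kappa * i.+1%:R + th)^-1 in
     D i.+1 <= (1 - 2 * kappa * eta) * D i + 2 * kappa * eta * e + eta ^+ 2 * B) ->
  (kappa * n%:R + th) * (D n - e) <= th * D2 + B / kappa * harmonic_sum R n.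
Proof.
move=> k0 kth B0 e0 D20 DD; have th0 : 0 < th by apply: lt_le_trans kth.
elim: n => [|n IH] h.
  rewrite mulr0 add0r /harmonic_sum big_ord0 mulr0 addr0 ler_wpM2l ?(ltW th0)//.
  lra.
have {}IH := IH (fun i hi => h i (ltnW hi)).
have := h n (ltnSn n); cbv zeta.
set w := kappa * n.+1%:R + th.
have w0 : 0 < w by rewrite addr_gt0// mulr_gt0.
have wE : w = kappa * n%:R + th + kappa by rewrite /w -natr1; ring.
have n0 : 0 <= kappa * n%:R by rewrite mulr_ge0// ltW.
have wi : w^-1 <= (kappa * n.+1%:R)^-1.
  by rewrite lef_pV2 ?posrE ?mulr_gt0// /w lerDl ltW.
move=> h1.
have h2 : w * (D n.+1 - e) <= (w - 2 * kappa) * (D n - e) + w^-1 * B.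
  have -> : (w - 2 * kappa) * (D n - e) + w^-1 * B =
    w * ((1 - 2 * kappa / w) * D n + 2 * kappa / w * e + w^-1 ^+ 2 * B - e).
    by field; rewrite gt_eqF.
  by rewrite ler_wpM2l ?(ltW w0)//; lra.
apply: le_trans h2 _.
rewrite /harmonic_sum big_ord_recr/= -/(harmonic_sum R n) [B / kappa * _]mulrDr addrA.
have H0 : 0 <= harmonic_sum R n by apply: sumr_ge0 => i _; rewrite invr_ge0.
apply: lerD; last first.
  by rewrite mulrC -mulrA -invfM ler_wpM2l.
(* A positive excess allows raising [w - 2 * kappa] to the coefficient of [IH]; a nonpositive one
   makes the left side nonpositive, since [kappa <= th]. *)
have [|h3] := lerP (D n) e.
  move=> h3; apply: (@le_trans _ _ 0).
    by rewrite mulr_ge0_le0 ?subr_le0//; lra.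
  by rewrite addr_ge0 ?mulr_ge0// ?invr_ge0 ltW.
apply: le_trans IH; rewrite ler_wpM2r ?subr_ge0 ?(ltW h3)//; lra.
Qed.

(** * Measurability of the iterates *)

Section Measurability.
Variables (R : realType) (n : nat) (S : set 'rV[R]_n).
Hypotheses (cptS : compact S) (cvxS : convex_rV S).
Variables (mu : R) (Ts T : nat) (eta : nat -> R) (p1 : 'rV[R]_n).

(** Epochs are counted from zero here: [j.+1] stands for k(t). *)
Definition anchor_point (U : Type) (pi : nat -> U -> 'rV[R]_n) (j : nat) (w : U) :=
  p1 + (j.+1%:R / j.+2%:R) *: (pi (Ts * j + 1)%N w - p1).

Definition is_trajectory (U : Type) (fb pi : nat -> U -> 'rV[R]_n) :=
  (forall w, pi 1%N w = p1) /\
  forall t, (1 <= t <= T)%N -> forall w,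
    is_projection S (pi t w + eta t *: (fb t w
      - mu *: (pi t w - anchor_point pi ((t - 1) %/ Ts) w))) (pi t.+1 w).

(** The sigma-algebra on [U] is left free: it is later both the ambient one and the one generated by
    past feedback, which makes the iterates adapted. *)
Lemma trajectory_measurable d (U : measurableType d)
    (fb pi : nat -> U -> 'rV[R]_n) (t : nat) :
  S !=set0 -> is_trajectory fb pi ->
  (forall s j, (1 <= s < t)%N -> measurable_fun setT (fun w => fb s w 0 j)) ->
  (1 <= t <= T.+1)%N -> forall j, measurable_fun setT (fun w => pi t w 0 j).
Proof.
move=> S0 [pi1 step].
have [Pj PjP] := choice (fun y => projection_exists cptS cvxS y S0).
elim/ltn_ind: t => -[//|[|t]] IH mfb tT j.
  by under eq_fun do rewrite pi1; exact: measurable_cst.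
have tT' : (1 <= t.+1 <= T)%N by [].
have mpi s : (1 <= s <= t.+1)%N -> forall j, measurable_fun setT (fun w => pi s w 0 j).
  move=> /andP[s1 st]; apply: IH => //.
    by move=> s' j' /andP[h1 h2]; apply: mfb; rewrite h1/= (ltn_trans h2).
  by rewrite s1 (leq_trans st)// ltnW//; case/andP: tT.
(* By uniqueness the new iterate is the total, 1-Lipschitz map [Pj] of earlier data, as
   [measurable_lipschitz] requires. *)
have -> : (fun w => pi t.+2 w 0 j) = (fun w => Pj (pi t.+1 w + eta t.+1 *: (fb t.+1 w
      - mu *: (pi t.+1 w - anchor_point pi ((t.+1 - 1) %/ Ts) w))) 0 j).
  apply/funext => w; congr fun_of_matrix.
  exact: projection_uniq (step _ tT' w) (PjP _).
apply: (@measurable_lipschitz R n _ U _ (fun y => Pj y 0 j) 1); last first.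
  move=> a b; rewrite mul1r; have <- : (Pj a - Pj b) 0 j = Pj a 0 j - Pj b 0 j.
    by rewrite !mxE.
  exact: le_trans (coord_le_l2norm _ _) (projection_nonexpansive (PjP _) (PjP _)).
move=> i; under eq_fun do rewrite !mxE.
have m1 := mpi t.+1 (leqnn _) i.
have m2 : measurable_fun setT (fun w => pi (Ts * ((t.+1 - 1) %/ Ts) + 1)%N w 0 i).
  apply: mpi; rewrite addn1 ltnS leq0n/= subn1/= ltnS.
  by rewrite mulnC leq_trunc_div.
have m3 : measurable_fun setT (fun w => fb t.+1 w 0 i) by apply: mfb; rewrite ltnSn.
have mc (c : R) : measurable_fun setT (fun _ : U => c) by exact: measurable_cst.
apply: measurable_funD => //; apply: measurable_funM => //.
apply: measurable_funB => //; apply: measurable_funM => //.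
apply: measurable_funB => //; apply: measurable_funD => //.
by apply: measurable_funM => //; apply: measurable_funB.
Qed.

End Measurability.

(** * Expected distance to the idealised iterates *)

Section Expectation.
Variables (d : measure_display) (Omega : measurableType d) (R : realType).
Variable P : probability Omega R.
Variables (n : nat) (S : set 'rV[R]_n).
Hypotheses (cptS : compact S) (cvxS : convex_rV S).
Variables (W J : 'rV[R]_n -> 'rV[R]_n) (L mu zeta D V2 : R).
Hypotheses (L0 : 0 < L) (mu0 : 0 < mu).
Hypothesis Wmono : forall x y, S x -> S y -> dot (W x - W y) (x - y) <= 0.
Hypothesis Wlip :
  forall x y, S x -> S y -> l2norm (W x - W y) <= L * l2norm (x - y).
Hypothesis Wzeta : forall x, S x -> l2norm (W x) <= zeta.
Hypothesis SD : forall x y, S x -> S y -> l2norm (x - y) <= D.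
Hypothesis JP : forall a, is_resolvent S W mu a (J a).

Variables (Ts T : nat) (eta : nat -> R) (th : R) (p1 : 'rV[R]_n).
Hypotheses (Ts0 : (0 < Ts)%N) (Sp1 : S p1) (muth : mu / 2 <= th).
Hypothesis etaE : forall j i, (i < Ts)%N ->
  eta (Ts * j + i.+1)%N = (mu / 2 * i.+1%:R + th)^-1.
Variables (pi xi : nat -> Omega -> 'rV[R]_n).

Let fb t w := W (pi t w) + xi t w.
Hypothesis traj : is_trajectory S mu Ts T eta p1 fb pi.

Definition history (fb' : nat -> Omega -> 'rV[R]_n) (t : nat) : set (set Omega) :=
  [set A | exists s j, (1 <= s < t)%N /\
    preimage_set_system setT (fun w => fb' s w 0 j) measurable A].

Local Notation integ f := (P.-integrable setT (EFin \o f)).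
Local Notation Ex f := (Rintegral P setT f).

Hypothesis xi_int : forall t, (1 <= t <= T)%N -> forall j,
  integ (fun w => xi t w 0 j).
Hypothesis xi_mean : forall t, (1 <= t <= T)%N -> forall j A,
  <<s history fb t >> A ->
  (\int[P]_(w in A) (xi t w 0 j)%:E = \int[P]_(w in A) (cst 0 w)%:E)%E.
Hypothesis xi_sq : forall t, (1 <= t <= T)%N -> integ (fun w => l2norm (xi t w) ^+ 2).
Hypothesis xi_var : forall t, (1 <= t <= T)%N ->
  Ex (fun w => l2norm (xi t w) ^+ 2) <= V2.

Let S0 : S !=set0. Proof. by exists p1. Qed.

Let D0 : 0 <= D.
Proof. by rewrite (le_trans (l2norm_ge0 (p1 - p1)))// SD. Qed.

Lemma iterate_in t w : (1 <= t <= T.+1)%N -> S (pi t w).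
Proof.
case: traj => pi1 step; case: t => [//|[|t]] h; first by rewrite pi1.
exact: (step t.+1 h w).1.
Qed.

(** A joint induction: iterates depend on earlier feedback, and feedback on the current iterate.
    Composing [W] with the projection makes it Lipschitz everywhere. *)
Lemma iterate_feedback_measurable t : (1 <= t <= T.+1)%N ->
  (forall j, measurable_fun setT (fun w => pi t w 0 j)) /\
  ((t <= T)%N -> forall j, measurable_fun setT (fun w => fb t w 0 j)).
Proof.
have [Pj PjP] := choice (fun y => projection_exists cptS cvxS y S0).
elim/ltn_ind: t => t IH tT.
have mpi j : measurable_fun setT (fun w => pi t w 0 j).
  apply: (trajectory_measurable cptS cvxS S0 traj) => // s i /andP[s1 st].
  have sT : (s <= T)%N by case/andP: tT => _ tT; rewrite -ltnS (leq_trans st).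
  by apply: (IH s st _).2; rewrite // s1 ltnW.
split=> // tT' j; have tT1 : (1 <= t <= T)%N by rewrite tT' andbT; case/andP: tT.
under eq_fun do rewrite mxE.
apply: measurable_funD; last first.
  by have /measurable_int/measurable_EFinP := xi_int tT1 j.
have -> : (fun w => W (pi t w) 0 j) = (fun w => W (Pj (pi t w)) 0 j).
  apply/funext => w; congr (W _ 0 j).
  exact: projection_uniq (projection_id (iterate_in w tT)) (PjP _).
apply: (@measurable_lipschitz R n _ Omega _ (fun y => W (Pj y) 0 j) L) => // a b.
have <- : (W (Pj a) - W (Pj b)) 0 j = W (Pj a) 0 j - W (Pj b) 0 j by rewrite !mxE.
apply: le_trans (coord_le_l2norm _ _) _.
apply: le_trans (Wlip (PjP a).1 (PjP b).1) _.
by rewrite ler_wpM2l ?(ltW L0)// (projection_nonexpansive (PjP _) (PjP _)).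
Qed.

Lemma history_measurable t : (1 <= t <= T)%N ->
  <<s history fb t >> `<=` @measurable _ Omega.
Proof.
move=> /andP[t1 tT]; apply: smallest_sub; first exact: sigma_algebra_measurable.
move=> A [s [j [/andP[s1 st] [B mB <-]]]].
have sT : (s <= T)%N by rewrite (leq_trans _ tT)// ltnW.
by apply: (iterate_feedback_measurable _).2 => //; rewrite s1 ltnW.
Qed.

(** The iterate at time [t] is determined by the feedback before [t], so each coordinate of
    [pi t w - q] is a bounded factor measurable for the past. *)
Lemma noise_orthogonal t q : (1 <= t <= T)%N -> S q ->
  integ (fun w => dot (xi t w) (pi t w - q)) /\
  Ex (fun w => dot (xi t w) (pi t w - q)) = 0.
Proof.
move=> tT Sq; have tT1 : (1 <= t <= T.+1)%N.
  by case/andP: tT => -> h; rewrite ltnW.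
have bd j w : `|(pi t w - q) 0 j| <= D.
  by apply: le_trans (coord_le_l2norm _ _) (SD _ Sq); exact: iterate_in.
have mF j : measurable_fun (setT : set (g_sigma_algebraType (history fb t)))
    (fun w => (pi t w - q) 0 j).
  under eq_fun do rewrite !mxE.
  apply: measurable_funB => //.
  apply: (@trajectory_measurable R n S cptS cvxS mu Ts T eta p1 _
    (g_sigma_algebraType (history fb t)) fb pi t S0 traj) => // s i st _ B mB.
  by apply: sub_sigma_algebra; exists s, i; split => //; exists B.
have mO := history_measurable tT.
have i1 j : integ (fun w => xi t w 0 j * (pi t w - q) 0 j).
  apply: (@integrable_bounded_mul _ _ _ P _ _ D) => //; first exact: xi_int.
  by have := measurable_fun_sub mO (mF j).
split; first exact: integ_sum.
rewrite Ex_sum//; apply: big1 => j _.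
exact: (@Ex_mul_eq0 _ _ _ P _ mO _ (xi_int tT j) (xi_mean tT j) _ D).
Qed.

Lemma iterate_sq_integrable t q : (1 <= t <= T.+1)%N -> S q ->
  integ (fun w => l2norm (pi t w - q) ^+ 2).
Proof.
move=> tT Sq; apply: (@integrable_bounded _ _ _ P _ (D ^+ 2)); last first.
  move=> w; rewrite ger0_norm ?sqr_ge0// ler_pXn2r ?nnegrE ?l2norm_ge0 ?D0//.
  by apply: SD => //; exact: iterate_in.
under eq_fun do rewrite l2norm_sqr.
apply: measurable_sum => j; apply: measurable_funM; under eq_fun do rewrite !mxE;
  apply: measurable_funB => //; exact: (iterate_feedback_measurable tT).1.
Qed.

Let abar j := halpern J p1 j.
Let anch j w := anchor_point Ts p1 pi j w.
Let err j := Ex (fun w => l2norm (anch j w - abar j) ^+ 2).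
Let dist t q := Ex (fun w => l2norm (pi t w - q) ^+ 2).


Let M2 := (zeta + mu * D) ^+ 2 + V2.

Let abar_in j : S (abar j).
Proof.
case: j => // j; rewrite /abar /=; apply: cvxS => //.
  exact: (JP _).1.
by rewrite ler_pdivrMr ?ltr0n// mul1r ler_nat.
Qed.

Let epoch_index j i : (i < Ts)%N -> ((Ts * j + i.+1 - 1) %/ Ts = j)%N.
Proof.
by move=> iT; rewrite addnS subn1/= mulnC divnMDl// divn_small// addn0.
Qed.

Let anch_in j w : (Ts * j <= T)%N -> S (anch j w).
Proof.
move=> jT; apply: cvxS => //; first by apply: iterate_in; rewrite addn1.
by rewrite ler_pdivrMr ?ltr0n// mul1r ler_nat.
Qed.

Let anch_sq_integrable j : (Ts * j <= T)%N ->
  integ (fun w => l2norm (anch j w - abar j) ^+ 2).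
Proof.
move=> jT; apply: (@integrable_bounded _ _ _ P _ (D ^+ 2)); last first.
  move=> w; rewrite ger0_norm ?sqr_ge0// ler_pXn2r ?nnegrE ?l2norm_ge0 ?D0//.
  by apply: SD => //; exact: anch_in.
under eq_fun do rewrite l2norm_sqr.
have m i : measurable_fun setT (fun w => pi (Ts * j + 1)%N w 0 i).
  by apply: (iterate_feedback_measurable _).1; rewrite addn1.
by apply: measurable_sum => i; apply: measurable_funM; under eq_fun do rewrite !mxE;
  apply: measurable_funB => //; apply: measurable_funD => //;
  apply: measurable_funM => //; apply: measurable_funB.
Qed.

(** The comparator [q] is deterministic, so [noise_orthogonal] removes the noise term of
    [perturbed_step]. *)
Lemma expected_step j i : (i < Ts)%N -> (Ts * j + i.+1 <= T)%N ->
  let q := J (abar j) in let t := (Ts * j + i.+1)%N in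
  dist t.+1 q <= (1 - eta t * mu) * dist t q + eta t * mu * err j
                 + eta t ^+ 2 * (2 * M2).
Proof.
move=> iT tT; cbv zeta; set q := J (abar j); set t := (Ts * j + i.+1)%N.
have tT1 : (1 <= t <= T)%N by rewrite {1}/t addnS.
have tT2 : (1 <= t <= T.+1)%N by case/andP: tT1 => -> h; rewrite ltnW.
have jT : (Ts * j <= T)%N by apply: leq_trans tT; rewrite leq_addr.
have Sq : S q := (JP _).1.
have eta0 : 0 < eta t.
  rewrite etaE// invr_gt0 addr_gt0 ?mulr_gt0 ?divr_gt0//.
  by apply: lt_le_trans muth; rewrite divr_gt0.
have i1 := iterate_sq_integrable tT2 Sq.
have i2 := anch_sq_integrable jT.
have [i3 E3] := noise_orthogonal tT1 Sq.
have i4 := xi_sq tT1.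
set z := zeta + mu * D.
pose rhs w := (1 - eta t * mu) * l2norm (pi t w - q) ^+ 2
  + (eta t * mu * l2norm (anch j w - abar j) ^+ 2
  + (2 * eta t ^+ 2 * (z ^+ 2 + l2norm (xi t w) ^+ 2)
  + 2 * eta t * dot (xi t w) (pi t w - q))).
have i5 : integ (fun w => z ^+ 2 + l2norm (xi t w) ^+ 2).
  by apply: integD => //; exact: integ_cst.
have j1 := integZ (1 - eta t * mu) i1.
have j2 := integZ (eta t * mu) i2.
have j3 := integZ (2 * eta t ^+ 2) i5.
have j4 := integZ (2 * eta t) i3.
have j34 := integD j3 j4; have j234 := integD j2 j34.
have irhs : integ rhs := integD j1 j234.
have E1 : Ex rhs = (1 - eta t * mu) * dist t q + (eta t * mu * err j
    + (2 * eta t ^+ 2 * (z ^+ 2 + Ex (fun w => l2norm (xi t w) ^+ 2)))).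
  rewrite /rhs (ExD j1 j234) (ExD j2 j34) (ExD j3 j4).
  rewrite (ExZ _ i1) (ExZ _ i2) (ExZ _ i5) (ExZ _ i3) (ExD (integ_cst P _) i4).
  by rewrite Ex_cst E3 mulr0 addr0.
apply: (@le_trans _ _ (Ex rhs)).
  apply: le_Ex => //; first by apply: iterate_sq_integrable.
  move=> w; rewrite /rhs !addrA.
  have Sx := iterate_in w tT2.
  have tj : ((t - 1) %/ Ts = j)%N := epoch_index j iT.
  have := traj.2 t tT1 w; rewrite tj => hp.
  exact: (perturbed_step Wmono mu0 eta0 Sx (JP _) hp (Wzeta Sx)
    (SD Sx (anch_in w jT))).
rewrite E1 addrA lerD2l mulrA [eta t ^+ 2 * 2]mulrC.
apply: ler_wpM2l; first exact: (mulr_ge0 _ (sqr_ge0 _)).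
by rewrite /M2 lerD2l xi_var.
Qed.

Variables (K0 : nat) (sm : R).
Hypothesis K0_gt0 : (0 < K0)%N.
Hypothesis smP : forall i, (0 < i <= T)%N -> (Ts <= i * K0)%N ->
  th * D ^+ 2 + 2 * M2 / (mu / 2) * harmonic_sum R i <= sm * (mu / 2 * i%:R).

(** [sgd_recursion] started from the diameter bound; [sm] is the error added by one epoch, whether
    complete or cut to a length of at least [Ts / K0]. *)
Lemma expected_epoch j i : (0 < i <= Ts)%N -> (Ts * j + i <= T)%N ->
  (Ts <= i * K0)%N ->
  dist (Ts * j + i).+1 (J (abar j)) <= err j + sm.
Proof.
move=> /andP[i0 iT] tT iK.
have jT : (Ts * j <= T)%N by apply: leq_trans tT; rewrite leq_addr.
have k0 : 0 < mu / 2 by rewrite divr_gt0.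
have err0 : 0 <= err j by apply: Rintegral_ge0 => w _; exact: sqr_ge0.
have M20 : 0 <= 2 * M2.
  rewrite mulr_ge0// addr_ge0 ?sqr_ge0//.
  have T1 : (1 <= Ts * j + i <= T)%N by rewrite tT andbT ltn_addl.
  by apply: le_trans (xi_var T1); apply: Rintegral_ge0 => w _; exact: sqr_ge0.
have Sq : S (J (abar j)) := (JP _).1.
have d0 : dist (Ts * j + 1) (J (abar j)) <= D ^+ 2.
  rewrite -[leRHS](Ex_cst P); apply: le_Ex.
  - by apply: iterate_sq_integrable => //; rewrite addn1.
  - exact: integ_cst.
  - move=> w; rewrite ler_pXn2r ?nnegrE ?l2norm_ge0 ?D0// SD//.
    by apply: iterate_in; rewrite addn1.
have := @sgd_recursion R (mu / 2) th (2 * M2) (err j) (D ^+ 2)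
  (fun i => dist (Ts * j + i).+1 (J (abar j))) i k0 muth M20 err0 (sqr_ge0 _).
rewrite addn0 -addn1 => /(_ d0) h.
have {}h : (mu / 2 * i%:R + th) * (dist (Ts * j + i).+1 (J (abar j)) - err j)
    <= sm * (mu / 2 * i%:R).
  apply: le_trans (h _) (smP _ iK); last first.
    by rewrite i0 (leq_trans _ tT)// leq_addl.
  move=> i' i'i; cbv zeta.
  have := @expected_step j i' (leq_trans i'i iT).
  rewrite /= etaE ?(leq_trans i'i iT)// !addnS => h1.
  apply: le_trans (h1 _) _; first by apply: leq_trans tT; rewrite -addnS leq_add2l.
  rewrite le_eqVlt; apply/orP; left; apply/eqP.
  by field; rewrite gt_eqF// addr_gt0// ?mulr_gt0//; apply: lt_le_trans muth.
have i0' : 0 < mu / 2 * i%:R by rewrite mulr_gt0// ltr0n.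
(* A nonpositive excess needs [0 <= sm], which follows from [smP] as its left side is nonnegative;
   otherwise [th] is dropped from the weight. *)
rewrite addrC -lerBlDr; have [hneg|hpos] := lerP (dist (Ts * j + i).+1 (J (abar j)) - err j) 0.
  apply: (le_trans hneg); rewrite -(pmulr_lge0 _ i0').
  apply: le_trans (smP _ iK); last by rewrite i0 (leq_trans _ tT)// leq_addl.
  have H0 : 0 <= harmonic_sum R i by apply: sumr_ge0 => ? _; rewrite invr_ge0.
  apply: addr_ge0; first exact: mulr_ge0 (le_trans (ltW k0) muth) (sqr_ge0 _).
  exact: mulr_ge0 (divr_ge0 M20 (ltW k0)) H0.
rewrite -(ler_pM2r i0'); apply: le_trans h; rewrite mulrC ler_wpM2r ?(ltW hpos)//.
by rewrite lerDl; apply: le_trans muth; exact: ltW.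
Qed.

(** The new anchor error is the end-of-epoch distance to [J (abar j)] scaled by [j.+2 / j.+3], so
    each epoch adds at most [sm]; both initial anchors are [p1]. *)
Lemma err_le j : (Ts * j <= T)%N -> err j <= j%:R * sm.
Proof.
elim: j => [|j IH] jT.
  rewrite mul0r -[leRHS](Ex_cst P) /err le_eqVlt; apply/orP; left; apply/eqP.
  congr Rintegral; apply/funext => w.
  by rewrite /anch /anchor_point muln0 traj.1 subrr scaler0 addr0 subrr l2norm0 expr0n.
have jT' : (Ts * j <= T)%N by apply: leq_trans jT; rewrite leq_mul2l leqnSn orbT.
have jE : (Ts * j.+1 = Ts * j + Ts)%N by rewrite mulnS addnC.
apply: (@le_trans _ _ (dist (Ts * j + Ts).+1 (J (abar j)))).
  apply: le_Ex; first exact: anch_sq_integrable.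
    by apply: iterate_sq_integrable; [rewrite ltnS -jE|exact: (JP _).1].
  move=> w; have -> : anch j.+1 w - abar j.+1 =
      (j.+2%:R / j.+3%:R) *: (pi (Ts * j + Ts).+1 w - J (abar j)).
    rewrite /anch /anchor_point /abar/= jE addn1.
    by apply/rowP => i; rewrite !mxE; ring.
  rewrite l2normZ ger0_norm ?divr_ge0// exprMn ler_piMl ?sqr_ge0//.
  by rewrite exprn_ile1 ?divr_ge0// ler_pdivrMr ?ltr0n// mul1r ler_nat.
apply: le_trans (expected_epoch _ _ _) _; rewrite -?jE ?Ts0 ?leqnn ?leq_pmulr//.
by rewrite -natr1 mulrDl mul1r lerD2r IH.
Qed.

Lemma expected_final j i : (0 < i <= Ts)%N -> (Ts * j + i = T)%N ->
  (Ts <= i * K0)%N ->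
  integ (fun w => l2norm (pi T.+1 w - J (halpern J p1 j)) ^+ 2) /\
  Ex (fun w => l2norm (pi T.+1 w - J (halpern J p1 j)) ^+ 2) <= j.+1%:R * sm.
Proof.
move=> hi tT iK; split.
  by apply: iterate_sq_integrable; [rewrite leqnn|exact: (JP _).1].
have := expected_epoch hi (eq_leq tT) iK; rewrite tT => h.
apply: le_trans h _.
by rewrite -natr1 mulrDl mul1r lerD2r err_le// -tT leq_addr.
Qed.

End Expectation.

(** * The gap function and the flattened game *)

Section Gap.
Variables (R : realType) (n : nat) (S : set 'rV[R]_n).
Variables (W : 'rV[R]_n -> 'rV[R]_n) (L mu zeta D : R).
Hypotheses (L0 : 0 < L) (mu0 : 0 < mu).
Hypothesis Wlip :
  forall x y, S x -> S y -> l2norm (W x - W y) <= L * l2norm (x - y).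
Hypothesis Wzeta : forall x, S x -> l2norm (W x) <= zeta.
Hypothesis SD : forall x y, S x -> S y -> l2norm (x - y) <= D.

Definition gap (x : 'rV[R]_n) : R := sup [set dot (W x) (y - x) | y in S].

Lemma gap_has_sup x : S x -> has_sup [set dot (W x) (y - x) | y in S].
Proof.
move=> Sx; split; first by exists (dot (W x) (x - x)), x.
exists (zeta * D) => _ [y Sy <-]; apply: le_trans (dot_le _ _) _.
by rewrite ler_pM ?l2norm_ge0 ?Wzeta ?SD.
Qed.

Lemma gap_ge0 x : S x -> 0 <= gap x.
Proof.
move=> Sx; apply: (sup_upper_bound (gap_has_sup Sx)); exists x => //.
by rewrite subrr -(scale0r 0) dotZr mul0r.
Qed.

(** Replacing [W x] by [W x'] costs [L * D] per unit of distance, and moving the base point costs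
    [zeta]. *)
Lemma gap_lipschitz x x' : S x -> S x' ->
  gap x <= gap x' + (L * D + zeta) * l2norm (x - x').
Proof.
move=> Sx Sx'; apply: sup_le_ub; first by have [] := gap_has_sup Sx.
move=> _ [y Sy <-].
have h1 : dot (W x') (y - x') <= gap x'.
  by apply: (sup_upper_bound (gap_has_sup Sx')); exists y.
have h2 : dot (W x - W x') (y - x) <= L * l2norm (x - x') * D.
  by apply: le_trans (dot_le _ _) _; rewrite ler_pM ?l2norm_ge0 ?Wlip ?SD.
have h3 : dot (W x') (x' - x) <= zeta * l2norm (x - x').
  apply: le_trans (dot_le _ _) _; rewrite (l2normBC x').
  by rewrite ler_wpM2r ?l2norm_ge0 ?Wzeta.
have -> : dot (W x) (y - x) =
    dot (W x - W x') (y - x) + dot (W x') (y - x') + dot (W x') (x' - x).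
  by rewrite !dotE; ring.
by lra.
Qed.

(** The variational inequality of [q] leaves only the pull [mu * dot (q - a) (y - q)], so a small
    residual means a small gap. *)
Lemma gap_resolvent a q : is_resolvent S W mu a q ->
  gap q <= mu * (D * l2norm (a - q)).
Proof.
move=> [Sq hq]; apply: sup_le_ub; first by have [] := gap_has_sup Sq.
move=> _ [y Sy <-].
have h1 := hq _ Sy.
have h2 : dot (q - a) (y - q) <= l2norm (a - q) * D.
  apply: le_trans (dot_le _ _) _; rewrite (l2normBC q).
  by rewrite ler_wpM2l ?l2norm_ge0 ?SD.
have h3 : mu * dot (q - a) (y - q) <= mu * (l2norm (a - q) * D).
  by rewrite ler_wpM2l// ltW.
have -> : dot (W q) (y - q) =
    dot (W q - mu *: (q - a)) (y - q) + mu * dot (q - a) (y - q).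
  by rewrite [in RHS]dotDl dotNl dotZl; ring.
by lra.
Qed.

End Gap.

Section Flatten.
Variables (R : realType) (N : nat) (dim : 'I_N -> nat).
Implicit Types p q : profile R dim.

(** Enumerating the pairs of a player and a coordinate turns the game into one operator on a single
    space of row vectors. *)
Definition profile_dim : nat := #|{: {i : 'I_N & 'I_(dim i)}}|.

Definition flat p : 'rV[R]_profile_dim :=
  \row_k p (tag (enum_val k)) 0 (tagged (enum_val k)).

Definition unflat (x : 'rV[R]_profile_dim) : profile R dim :=
  fun i => \row_j x 0 (enum_rank (Tagged (fun i => 'I_(dim i)) j)).

Lemma flatE p i (j : 'I_(dim i)) :
  flat p 0 (enum_rank (Tagged (fun i => 'I_(dim i)) j)) = p i 0 j.
Proof. by rewrite mxE enum_rankK. Qed.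

Lemma flatK : cancel flat unflat.
Proof.
move=> p; apply: functional_extensionality_dep => i.
by apply/rowP => j; rewrite mxE flatE.
Qed.

Lemma unflatK : cancel unflat flat.
Proof.
move=> x; apply/rowP => k; rewrite !mxE; congr (x 0 _).
by rewrite -[RHS]enum_valK; case: (enum_val k).
Qed.

Lemma flatB p q : flat (psub p q) = flat p - flat q.
Proof. by apply/rowP => k; rewrite !mxE. Qed.

Lemma dot_flat p q : dot (flat p) (flat q) = pdot p q.
Proof.
rewrite /pdot /dot sig_big_dep /=.
rewrite [RHS](reindex (@enum_val _ {: {i : 'I_N & 'I_(dim i)}})) /=; last first.
  exact: onW_bij (@enum_val_bij _).
by apply: eq_bigr => k _; rewrite !mxE.
Qed.

Lemma l2norm_flat p : l2norm (flat p) = pnorm p.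
Proof. by rewrite /l2norm dot_flat. Qed.

Variable X : forall i, set 'rV[R]_(dim i).
Arguments X : clear implicits.

Definition flat_profiles := flat @` strategy_profiles X.

Lemma flat_profilesP x : flat_profiles x <-> strategy_profiles X (unflat x).
Proof.
split=> [[p Xp <-]|Xx]; first by rewrite flatK.
by exists (unflat x) => //; rewrite unflatK.
Qed.

(** Tychonoff gives compactness of the product, and [flat] is continuous since each of its finitely
    many coordinates is. *)
Lemma flat_profiles_compact :
  (forall i, compact (X i)) -> compact flat_profiles.
Proof.
move=> /tychonoff cX.
apply: continuous_compact cX; apply: continuous_subspaceT => p A [B Bp BA].
pose proj_k (k : 'I_profile_dim) (q : prod_topology (fun i => 'rV[R]_(dim i))) :=
  q (tag (enum_val k)) 0 (tagged (enum_val k)) : R.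
pose p' : prod_topology (fun i => 'rV[R]_(dim i)) := p.
have : \forall q \near nbhs p', forall k, B 0 k (proj_k k q).
  apply: (@filter_forall _ _ (fun k q => B 0 k (proj_k k q)) (nbhs p') (nbhs_filter p')).
  move=> k; have := Bp 0 k; rewrite mxE => Bk.
  have c : {for p', continuous (proj_k k)}.
    apply: (@continuous_comp _ _ _
      (fun q : prod_topology (fun i => 'rV[R]_(dim i)) => q (tag (enum_val k)))
      (fun y : 'rV[R]_(dim (tag (enum_val k))) => y 0 (tagged (enum_val k)))).
      exact: (@proj_continuous _ (fun i => 'rV[R]_(dim i)) (tag (enum_val k))).
    exact: coord_continuous.
  exact: c.
apply: (@filterS _ _ (nbhs_filter p')) => q hq; apply: BA => i k; rewrite ord1 mxE; exact: hq.
Qed.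

Lemma flat_profiles_convex :
  (forall i, convex_set (X i)) -> convex_rV flat_profiles.
Proof.
move=> cX x y t /flat_profilesP Xx /flat_profilesP Xy t0 t1.
apply/flat_profilesP => i.
have -> : unflat (x + t *: (y - x)) i = unflat x i + t *: (unflat y i - unflat x i).
  by apply/rowP => j; rewrite !mxE.
exact: (convex_set_rV (cX i)).
Qed.

Lemma flat_projection (y z : profile R dim) :
  (forall i, is_projection (X i) (y i) (z i)) ->
  is_projection flat_profiles (flat y) (flat z).
Proof.
move=> h; split; first by exists z => // i; exact: (h i).1.
move=> _ [x Xx <-]; rewrite -!flatB dot_flat /pdot.
by apply: sumr_le0 => i _; exact: (h i).2.
Qed.

End Flatten.

(** * The update interval *)

(** The fractional powers of [T] become integer powers of [u], within reach of [field] and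
    [ring]. *)
Lemma seventh_root (R : realType) (T : nat) (u := T%:R `^ (1 / 7) : R) :
  (0 < T)%N ->
  [/\ 1 <= u, u ^+ 7 = T%:R & Num.max (T%:R `^ (6 / 7)) 1 = u ^+ 6].
Proof.
move=> T0.
have T1 : (1 : R) <= T%:R by rewrite ler1n.
have u1 : 1 <= u.
  apply: (@le_trans _ _ (1 `^ (1 / 7))); first by rewrite powR1.
  by rewrite ge0_ler_powR// ?nnegrE// divr_ge0.
split=> //.
  rewrite -powR_mulrn ?powR_ge0// -powRrM mul1r mulVf ?pnatr_eq0//.
  by rewrite powRr1.
have -> : T%:R `^ (6 / 7) = u ^+ 6.
  by rewrite -powR_mulrn ?powR_ge0// -powRrM; congr (_ `^ _); ring.
by apply/max_idPl; rewrite exprn_ege1.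
Qed.

(* [(T K0)^7 = T T0^6 Ts^7] makes [Ts] divide [T K0], so the last epoch, even
   if incomplete, has length at least [Ts / K0]. *)
Lemma update_interval_dvd (R : realType) (c : R) : 1 <= c ->
  exists2 K0 : nat, (0 < K0)%N &
  forall T Ts : nat, (2 <= T)%N -> Ts%:R = c * Num.max (T%:R `^ (6 / 7)) 1 ->
    (Ts %| T * K0)%N.
Proof.
move=> c1.
have pow7 T Ts : (2 <= T)%N -> Ts%:R = c * Num.max (T%:R `^ (6 / 7)) 1 ->
    (0 < Ts)%N /\ Ts%:R ^+ 7 = c ^+ 7 * T%:R ^+ 6.
  move=> T2; have [u1 uT ->] := @seventh_root R T (ltnW T2).
  move: (_ `^ _) u1 uT => u u1 <- TsE; split.
    rewrite -(ltr0n R) TsE mulr_gt0 ?exprn_gt0//.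
      exact: lt_le_trans c1.
    exact: lt_le_trans u1.
  by rewrite TsE; ring.
(* [K0] is the update interval of one fixed admissible pair; if there is none, the claim is
   vacuous. *)
have [[[T0 K0] [/= T02 K0E]]|no] := pselect (exists z : nat * nat, (2 <= z.1)%N /\
    z.2%:R = c * Num.max (z.1%:R `^ (6 / 7)) 1).
  have [K00 K07] := pow7 _ _ T02 K0E.
  exists K0 => // T Ts T2 TsE; have [_ Ts7] := pow7 _ _ T2 TsE.
  rewrite -(@dvdn_pexp2r _ _ 7)//.
  suff -> : ((T * K0) ^ 7 = T * T0 ^ 6 * Ts ^ 7)%N by exact: dvdn_mull.
  apply/eqP; rewrite -(eqr_nat R) natrX (natrM _ T K0) (natrM _ (T * _) _).
  rewrite (natrM _ T _) !natrX exprMn.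
  by rewrite K07 Ts7; apply/eqP; ring.
by exists 1%N => // T Ts T2 TsE; case: no; exists (T, Ts).
Qed.

(** * Noise and dynamics in flattened coordinates *)

Section NoiseBounds.
Variables (d : measure_display) (Omega : measurableType d) (R : realType).
Variable P : probability Omega R.

Lemma cond_expectation_bound (F : set (set Omega)) (f g : Omega -> R) (b : R) :
  F setT -> is_cond_expectation P F f g -> {ae P, forall w, g w <= b} ->
  Rintegral P setT f <= b.
Proof.
move=> FT [fi gi _ fg] gb; rewrite /Rintegral fg// -/(Rintegral P setT g).
(* [h] dominates [g] everywhere and equals [b] almost everywhere, which makes the comparison
   pointwise. *)
pose h w := Num.max (g w) b.
have mg : measurable_fun setT g by have /measurable_int/measurable_EFinP := gi.
have mh : measurable_fun setT h by exact: measurable_maxr.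
have hb : (\int[P]_w (h w)%:E = \int[P]_w (cst b w)%:E)%E.
  apply: ae_eq_integral => //; [exact/measurable_EFinP|exact/measurable_EFinP|].
  by apply: filterS gb => w gw _; rewrite /h/= max_r.
have hi : P.-integrable setT (EFin \o h).
  have gi' : P.-integrable setT (EFin \o (fun w => `|g w| + `|b|)).
    by apply: integD; [exact: integrable_norm|exact: integ_cst].
  apply: le_integrable gi' => //; first exact/measurable_EFinP.
  move=> w _ /=; rewrite lee_fin (@ger0_norm _ (_ + _)) ?addr_ge0// /h.
  by case: (leP (g w) b) => _; rewrite ?lerDl ?lerDr normr_ge0.
apply: (@le_trans _ _ (Rintegral P setT h)).
  by apply: le_Ex => // w; rewrite le_max lexx.
by rewrite /Rintegral hb -/(Rintegral P setT (cst b)) [leLHS](Ex_cst P b).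
Qed.

End NoiseBounds.

Section FlatGame.
Variables (R : realType) (N : nat) (dim : 'I_N -> nat).

Lemma flat_history d (U : measurableType d)
    (fb : nat -> U -> profile R dim) t :
  feedback_filtration fb t = <<s history (fun t w => flat (fb t w)) t >>.
Proof.
congr (<<s _ >>); apply/seteqP; split=> A.
  move=> [s [i [j [st hA]]]].
  exists s, (enum_rank (Tagged (fun i => 'I_(dim i)) j)); split=> //.
  by under eq_fun do rewrite flatE.
move=> [s [k [st hA]]].
exists s, (tag (enum_val k)), (tagged (enum_val k)); split=> //.
rewrite (_ : (fun w => _) = fun w => flat (fb s w) 0 k)//.
by apply/funext => w; rewrite mxE.
Qed.

Variables (X : forall i : 'I_N, set 'rV[R]_(dim i)).
Arguments X : clear implicits.

Definition flat_operator (V : profile R dim -> profile R dim)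
    (x : 'rV[R]_(profile_dim dim)) := flat (V (unflat x)).

Lemma flat_noise d (Omega : measurableType d) (P : probability Omega R)
    (C : R) (T t : nat) (fb xi : nat -> Omega -> profile R dim) :
  noise_assumption P C T fb xi -> (1 <= t <= T)%N ->
  [/\ forall j, P.-integrable setT (EFin \o (fun w => flat (xi t w) 0 j)),
      forall j A, <<s history (fun t w => flat (fb t w)) t >> A ->
        (\int[P]_(w in A) (flat (xi t w) 0 j)%:E = \int[P]_(w in A) (cst 0 w)%:E)%E,
      P.-integrable setT (EFin \o (fun w => l2norm (flat (xi t w)) ^+ 2)) &
      Rintegral P setT (fun w => l2norm (flat (xi t w)) ^+ 2) <= N%:R * C ^+ 2].
Proof.
move=> noise tT; have hn := noise t tT.
have sqE : (fun w => l2norm (flat (xi t w)) ^+ 2) =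
    fun w => \sum_(i < N) l2norm (xi t w i) ^+ 2.
  apply/funext => w; rewrite l2norm_sqr dot_flat.
  by apply: eq_bigr => i _; rewrite l2norm_sqr.
have int i : P.-integrable setT (EFin \o (fun w => l2norm (xi t w i) ^+ 2)).
  by have [_ [g [fi _ _ _] _]] := hn i.
have coordE j : (fun w => flat (xi t w) 0 j) =
    fun w => xi t w (tag (enum_val j)) 0 (tagged (enum_val j)).
  by apply/funext => w; rewrite mxE.
split.
- by move=> j; rewrite coordE; have [h _] := hn (tag (enum_val j)); case: (h (tagged (enum_val j))).
- move=> j A; rewrite -flat_history => FA.
  have [h _] := hn (tag (enum_val j)); have [_ _ _ hA] := h (tagged (enum_val j)).
  by rewrite -hA//; apply: eq_integral => w _; rewrite mxE.
- by rewrite sqE; exact: integ_sum.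
rewrite sqE Ex_sum//.
have -> : N%:R * C ^+ 2 = \sum_(i < N) C ^+ 2.
  by rewrite big_const_ord iter_addr_0 mulr_natl.
apply: ler_sum => i _; have [_ [g hg gC]] := hn i.
apply: cond_expectation_bound hg gC.
exact: (@measurableT _ (g_sigma_algebraType _)).
Qed.

(** Each player's maximisation is a projection, and the two perturbation terms merge into one pull
    towards [anchor_point]. *)
Lemma flat_trajectory (V : profile R dim -> profile R dim) (mu : R) (Ts T : nat)
    (eta : nat -> R) (pi1 : profile R dim) (Omega : Type)
    (pi xi : nat -> Omega -> profile R dim) :
  (forall i, convex_set (X i)) ->
  (forall w, is_GABP X mu Ts eta T pi1
    (fun t i => V (pi t w) i + xi t w i) (pi^~ w)) ->
  is_trajectory (flat_profiles X) mu Ts T eta (flat pi1)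
    (fun t w => flat_operator V (flat (pi t w)) + flat (xi t w))
    (fun t w => flat (pi t w)).
Proof.
move=> cX gabp; split=> [w|t tT w]; first by rewrite (gabp w).1.
have [pi1E step] := gabp w.
set j := ((t - 1) %/ Ts)%N.
pose y : profile R dim := fun i => pi t w i + eta t *: (V (pi t w) i + xi t w i
   - (mu / ((epoch Ts t)%:R + 1)) *: (anchor Ts (pi^~ w) (epoch Ts t) i
                                      - anchor Ts (pi^~ w) 1%N i)
   - mu *: (pi t w i - anchor Ts (pi^~ w) (epoch Ts t) i)).
have -> : flat (pi t w) + eta t *: (flat_operator V (flat (pi t w)) + flat (xi t w)
    - mu *: (flat (pi t w) - anchor_point Ts (flat pi1) (fun t w => flat (pi t w)) j w))
    = flat y.
  apply/rowP => k; rewrite /flat_operator /anchor_point flatK !mxE /anchor /epoch -/j.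
  rewrite !subn1/= muln0 add0n pi1E -!natr1; field.
  by rewrite !natr1 pnatr_eq0.
apply: flat_projection => i; have [Xz zmax] := step t tT i.
apply: argmax_is_projection => //; first exact: convex_set_rV.
by move=> x Xx; have := zmax x Xx; rewrite !dotZl.
Qed.

End FlatGame.

Lemma GAP_flat (R : realType) (N : nat) (dim : 'I_N -> nat)
    (X : forall i : 'I_N, set 'rV[R]_(dim i)) (V : profile R dim -> profile R dim) p :
  GAP (strategy_profiles X) V p = gap (flat_profiles X) (flat_operator V) (flat p).
Proof.
rewrite /GAP /gap /flat_operator flatK; congr sup; apply/seteqP; split => r.
  move=> [q Xq <-]; exists (flat q); first by exists q.
  by rewrite -flatB dot_flat.
move=> [_ [q Xq <-] <-]; exists q => //.
by rewrite -flatB dot_flat.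
Qed.

(** * Assembly of the rate *)

Lemma set_diameter (R : realType) (n : nat) (S : set 'rV[R]_n) : compact S ->
  exists2 D, 0 <= D & forall x y, S x -> S y -> l2norm (x - y) <= D.
Proof.
move=> cS; have [->|/set0P S0] := eqVneq S set0; first by exists 0.
have [|x0 Sx0 hx0] := @lipschitz_EVT_min R n 1 S (fun x => - l2norm x) cS S0.
  by move=> x y; rewrite mul1r opprK addrC distrC l2norm_dist.
exists (l2norm x0 + l2norm x0); first by rewrite addr_ge0 ?l2norm_ge0.
move=> x y Sx Sy; apply: le_trans (l2normD _ _) _; rewrite l2normN.
by rewrite lerD// -lerN2 hx0.
Qed.

Lemma epochE (Ts j i : nat) : (i < Ts)%N -> epoch Ts (Ts * j + i.+1) = j.+1.
Proof.
move=> iT; rewrite /epoch addnS subn1/= mulnC divnMDl ?divn_small ?addn0//.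
exact: leq_ltn_trans iT.
Qed.

Theorem theorem4p3 (R : realType) (N : nat) (dim : 'I_N -> nat)
    (X : forall i : 'I_N, set 'rV[R]_(dim i))
    (v : 'I_N -> profile R dim -> R) (V : profile R dim -> profile R dim)
    (L mu zeta C c : R) :
  let XX := strategy_profiles X in
  let kappa := mu / 2 in
  let theta := (3 * mu ^+ 2 + 8 * L ^+ 2) / (2 * mu) in
  (forall i, compact (X i)) ->
  (forall i, convex_set (X i)) ->
  is_gradient_operator XX v V ->
  monotone_game XX V ->
  0 < L ->
  lipschitz_game XX L V ->
  0 < mu ->
  (forall p, XX p -> pnorm (V p) <= zeta) ->
  0 < C ->
  1 <= c ->
  exists K : R, forall T Ts : nat,
    (2 <= T)%N ->
    Ts%:R = c * Num.max (T%:R `^ (6 / 7)) 1 ->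
    let eta := fun t : nat =>
      (kappa * (t%:R - (Ts * (epoch Ts t - 1))%:R) + 2 * theta)^-1 in
    forall (d : measure_display) (Omega : measurableType d)
      (P : probability Omega R) (pi1 : profile R dim)
      (pi xi : nat -> Omega -> profile R dim),
    let fb := fun (t : nat) (w : Omega) (i : 'I_N) => V (pi t w) i + xi t w i in
    XX pi1 ->
    noise_assumption P C T fb xi ->
    (forall w, is_GABP X mu Ts eta T pi1 (fb^~ w) (pi^~ w)) ->
    ('E_P[fun w => GAP XX V (pi T.+1 w)]
       <= (K * (ln T%:R / T%:R `^ (1 / 7)))%:E)%E.
Proof.
move=> XX kappa theta cptX cvxX gradV monoV L0 lipV mu0 Vzeta C0 c1.
set S := flat_profiles X; set W := flat_operator V.
have cptS : compact S by exact: flat_profiles_compact.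
have cvxS : convex_rV S by exact: flat_profiles_convex.
have Wmono x y : S x -> S y -> dot (W x - W y) (x - y) <= 0.
  move=> /flat_profilesP Xx /flat_profilesP Xy.
  by rewrite -[x]unflatK -[y]unflatK /W /flat_operator !flatK -!flatB dot_flat monoV.
have Wlip x y : S x -> S y -> l2norm (W x - W y) <= L * l2norm (x - y).
  move=> /flat_profilesP Xx /flat_profilesP Xy.
  by rewrite -[x]unflatK -[y]unflatK /W /flat_operator !flatK -!flatB !l2norm_flat lipV.
have Wzeta x : S x -> l2norm (W x) <= zeta.
  by move=> /flat_profilesP Xx; rewrite /W /flat_operator l2norm_flat Vzeta.
have [D D0 SD] := set_diameter cptS.
have [K0 K00 K0P] := update_interval_dvd c1.
have k0 : 0 < kappa by rewrite divr_gt0.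
have th0 : 0 < 2 * theta.
  rewrite mulr_gt0// divr_gt0 ?mulr_gt0// addr_gt0// mulr_gt0// exprn_gt0//.
have kth : kappa <= 2 * theta.
  have -> : 2 * theta = 3 * mu + 8 * L ^+ 2 / mu.
    by rewrite /theta; field; rewrite gt_eqF.
  have : 0 <= 8 * L ^+ 2 / mu by rewrite divr_ge0 ?mulr_ge0 ?sqr_ge0// ltW.
  rewrite /kappa; lra.
pose M2 := (zeta + mu * D) ^+ 2 + N%:R * C ^+ 2.
have M20 : 0 <= M2 := addr_ge0 (sqr_ge0 _) (mulr_ge0 (ler0n _ _) (sqr_ge0 _)).
pose A1 := L * D + zeta.
(* For [2 <= T] one has [1 <= l * ln T], which absorbs constants into the logarithm. *)
pose l : R := (ln 2)^-1.
pose Q1 := 2 * theta * D ^+ 2.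
pose Q2 := 2 * M2 / kappa.
(* The summands pay in turn for the Halpern residual, the Young remainder [A1 / u] and the expected
   squared distance of the last iterate. *)
exists (mu * D ^+ 2 * c * (4 * l + 1)
        + A1 * (l + 2 * K0%:R / kappa * (Q1 * l + Q2 * (l + 1)))).
move=> T Ts T2 TsE eta d Omega P pi1 pi xi fb Xpi1 noise gabp.
have c0 : 0 < c by exact: lt_le_trans c1.
have [u1 uT maxE] := @seventh_root R T (ltnW T2).
have TsK0 := K0P T Ts T2 TsE; rewrite maxE in TsE.
move: (T%:R `^ (1 / 7)) u1 uT TsE {maxE} => u u1 uT TsE.
have u0 : 0 < u by exact: lt_le_trans u1.
have Ts0 : (0 < Ts)%N by rewrite -(ltr0n R) TsE mulr_gt0// exprn_gt0.
have T0 : (0 < T)%N by exact: ltnW.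
pose p1 := flat pi1.
have Sp1 : S p1 by exists pi1.
have S0 : S !=set0 by exists p1.
have [J JP] := choice (fun a => resolvent_exists cptS cvxS L0 mu0 Wmono Wlip a S0).
pose pif t w := flat (pi t w); pose xif t w := flat (xi t w).
have traj : is_trajectory S mu Ts T eta p1 (fun t w => W (pif t w) + xif t w) pif.
  exact: flat_trajectory cvxX gabp.
have fbE : (fun t w => W (pif t w) + xif t w) = fun t w => flat (fb t w).
  apply/funext => t; apply/funext => w; rewrite /W /flat_operator /pif /xif flatK.
  by apply/rowP => j; rewrite !mxE.
have noisef t : (1 <= t <= T)%N -> _ := fun h => flat_noise noise h.
have etaE j i : (i < Ts)%N ->
    eta (Ts * j + i.+1)%N = (mu / 2 * i.+1%:R + 2 * theta)^-1.
  move=> iT; rewrite /eta epochE// subn1/= -natrB ?leq_addr//.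
  by rewrite addKn.
pose lnT : R := ln T%:R.
have l0 : 0 < l by rewrite invr_gt0 ln_gt0// ltr1n.
have llnT : 1 <= l * lnT.
  rewrite /l mulrC ler_pdivlMr ?ln_gt0 ?ltr1n// mul1r.
  by rewrite ler_ln ?posrE ?ltr0n ?ler_nat.
have lnT0 : 0 <= lnT by rewrite ln_ge0// ler1n.
have Q10 : 0 <= Q1 := mulr_ge0 (ltW th0) (sqr_ge0 _).
have Q20 : 0 <= Q2 := divr_ge0 (mulr_ge0 (ler0n _ 2) M20) (ltW k0).
(* The factor [K0] covers an epoch cut to a length [i >= Ts / K0]. *)
pose sm := K0%:R * (Q1 + Q2 * (1 + lnT)) / (kappa * Ts%:R).
have Ts0' : (0 : R) < Ts%:R by rewrite ltr0n.
have smP i : (0 < i <= T)%N -> (Ts <= i * K0)%N ->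
    2 * theta * D ^+ 2 + 2 * M2 / (mu / 2) * harmonic_sum R i <= sm * (mu / 2 * i%:R).
  move=> /andP[i0 iT] iK; rewrite -/kappa -/Q1 -/Q2.
  have i0' : (0 : R) < i%:R by rewrite ltr0n.
  apply: (@le_trans _ _ (Q1 + Q2 * (1 + lnT))).
    rewrite lerD2l ler_wpM2l// (le_trans (harmonic_sum_le R i0))// lerD2l.
    by rewrite ler_ln ?posrE ?ltr0n// ler_nat.
  have -> : sm * (kappa * i%:R) = (i * K0)%:R / Ts%:R * (Q1 + Q2 * (1 + lnT)).
    by rewrite natrM /sm; field; rewrite !gt_eqF.
  apply: ler_peMl; first exact: addr_ge0 Q10 (mulr_ge0 Q20 (addr_ge0 ler01 lnT0)).
  by rewrite ler_pdivlMr// mul1r ler_nat.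
(* Dividing [T - 1] rather than [T] makes the last epoch full, not empty, when [Ts] divides [T]. *)
pose j := ((T - 1) %/ Ts)%N; pose i := (T - Ts * j)%N.
have hT : (T - 1 = j * Ts + (T - 1) %% Ts)%N by exact: divn_eq.
have hr : ((T - 1) %% Ts < Ts)%N by rewrite ltn_mod.
have TE : T = (j * Ts + (T - 1) %% Ts).+1 by rewrite -hT subn1 prednK.
have iE : (i = ((T - 1) %% Ts).+1)%N.
  by rewrite /i [X in (X - _)%N]TE mulnC -addnS addKn.
have hi : (0 < i <= Ts)%N by rewrite iE.
have jiT : (Ts * j + i = T)%N by rewrite iE mulnC addnS -TE.
(* [Ts] divides [T * K0] and [Ts * j * K0], hence also the positive number [i * K0]. *)
have iK : (Ts <= i * K0)%N.
  apply: dvdn_leq; first by rewrite muln_gt0 K00 andbT; case/andP: hi.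
  have : (Ts %| Ts * j * K0 + i * K0)%N by rewrite -mulnDl jiT.
  by rewrite dvdn_addr// -mulnA dvdn_mulr.
pose q := J (halpern J p1 j).
have [dint dle] : P.-integrable setT (EFin \o (fun w => l2norm (pif T.+1 w - q) ^+ 2)) /\
    Rintegral P setT (fun w => l2norm (pif T.+1 w - q) ^+ 2) <= j.+1%:R * sm.
  apply: (@expected_final _ Omega R P _ S cptS cvxS W J L mu zeta D (N%:R * C ^+ 2)
    L0 mu0 Wmono Wlip Wzeta SD JP Ts T eta (2 * theta) p1 Ts0 Sp1 kth etaE pif xif
    traj _ _ _ _ K0 sm K00 smP j i hi jiT iK).
  - by move=> t tT; have [] := noisef t tT.
  - by rewrite fbE => t tT; have [] := noisef t tT.
  - by move=> t tT; have [] := noisef t tT.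
  - by move=> t tT; have [] := noisef t tT.
have z0 : 0 <= zeta by apply: le_trans (Wzeta _ Sp1); exact: l2norm_ge0.
have A10 : 0 <= A1 by rewrite addr_ge0// mulr_ge0// ltW.
have Sq : S q := (JP _).1.
have SpT w : S (pif T.+1 w).
  by apply: (iterate_in Sp1 traj); rewrite leqnn andbT.
pose g := gap S W.
have jle : j.+1%:R <= 2 * u.
  have : j%:R * Ts%:R <= T%:R :> R by rewrite -natrM ler_nat -jiT mulnC leq_addr.
  rewrite TsE -uT => h.
  have : j%:R <= u.
    rewrite -(@ler_pM2r _ (u ^+ 6)) ?exprn_gt0// -exprS; apply: le_trans h.
    rewrite ler_wpM2l// ler_peMl// exprn_ge0// ltW//.
  by rewrite -natr1; lra.
(* There are at least [u / c] epochs, which turns the Halpern rate [1 / j.+3] into [c / u]. *)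
have jge : u <= c * j.+3%:R.
  have : T%:R <= j.+1%:R * Ts%:R :> R.
    by rewrite -natrM ler_nat -jiT mulSn addnC mulnC leq_add2r; case/andP: hi.
  rewrite TsE -uT => h.
  have : u <= c * j.+1%:R.
    by rewrite -(@ler_pM2r _ (u ^+ 6)) ?exprn_gt0// -exprS -mulrA mulrCA.
  by move=> /le_trans; apply; rewrite ler_wpM2l ?(ltW c0)// ler_nat !ltnS leqW.
have gq : g q <= mu * D ^+ 2 * c * (4 + lnT) / u.
  apply: le_trans (gap_resolvent mu0 Wzeta SD (JP (halpern J p1 j))) _.
  have J1 x y : l2norm (J x - J y) <= l2norm (x - y).
    exact: (resolvent_nonexpansive mu0 Wmono (JP _) (JP _)).
  have h := @halpern_residual _ _ S J p1 D (fun x => (JP x).1) J1 Sp1 SD j.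
  rewrite -/q in h; set r := l2norm _ in h *.
  have ln_j : ln j.+1%:R <= lnT.
    rewrite ler_ln ?posrE ?ltr0n// ler_nat -jiT.
    have /andP[i0 _] := hi; rewrite -addn1 leq_add//.
    by rewrite leq_pmull.
  have h1 : u * r <= c * (D * (4 + lnT)).
    apply: (@le_trans _ _ (c * (j.+3%:R * r))).
      by rewrite mulrA ler_wpM2r ?l2norm_ge0.
    rewrite ler_wpM2l ?(ltW c0)// (le_trans h)// ler_wpM2l// lerD2l//.
  rewrite ler_pdivlMr//.
  have -> : mu * D ^+ 2 * c * (4 + lnT) = mu * D * (c * (D * (4 + lnT))) by ring.
  have -> : mu * (D * r) * u = mu * D * (u * r) by ring.
  by rewrite ler_wpM2l// mulr_ge0// ltW.
(* Young's inequality [a <= u^-1 + u * a ^+ 2] trades the distance for its square, whose expectation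
   is controlled; the remainder [u^-1] is within the target rate. *)
have gbound w : g (pif T.+1 w) <=
    g q + A1 * u^-1 + A1 * u * l2norm (pif T.+1 w - q) ^+ 2.
  apply: le_trans (gap_lipschitz Wlip Wzeta SD (SpT w) Sq) _.
  rewrite -/A1 -/g -addrA lerD2l -mulrA -mulrDr ler_wpM2l//.
  set a := l2norm _; rewrite -(ler_pM2l u0) mulrDr mulfV ?gt_eqF//.
  have : 0 <= (u * a - 2^-1) ^+ 2 by exact: sqr_ge0.
  by lra.
pose bound w := g q + A1 * u^-1 + A1 * u * l2norm (pif T.+1 w - q) ^+ 2.
have ibound : P.-integrable setT (EFin \o bound).
  by apply: integD; [exact: integ_cst|exact: integZ].
have Ebound : Rintegral P setT bound <=
    (mu * D ^+ 2 * c * (4 * l + 1)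
        + A1 * (l + 2 * K0%:R / kappa * (Q1 * l + Q2 * (l + 1)))) * (lnT / u).
  rewrite /bound (ExD (integ_cst P _) (integZ _ dint)) Ex_cst (ExZ _ dint).
  set Ed := Rintegral _ _ _ in dle *.
  have uI0 : 0 <= u^-1 by rewrite invr_ge0 ltW.
  have smE : u * (j.+1%:R * sm) <= 2 * K0%:R / kappa * (Q1 + Q2 * (1 + lnT)) / u.
    have sm0 : 0 <= K0%:R / kappa * (Q1 + Q2 * (1 + lnT)).
      apply: mulr_ge0; first by rewrite divr_ge0// ltW.
      exact: addr_ge0 Q10 (mulr_ge0 Q20 (addr_ge0 ler01 lnT0)).
    (* The first two factors are at most 1: the first by [jle], the second because [Ts = c * u ^+ 6]
       leaves powers of [u] to spare. *)
    have -> : u * (j.+1%:R * sm) = j.+1%:R / (2 * u) * (u / (c * u ^+ 4))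
        * (2 * (K0%:R / kappa * (Q1 + Q2 * (1 + lnT))) / u).
      by rewrite /sm TsE; field; rewrite !gt_eqF.
    have -> : 2 * K0%:R / kappa * (Q1 + Q2 * (1 + lnT)) / u =
        1 * (2 * (K0%:R / kappa * (Q1 + Q2 * (1 + lnT))) / u) by ring.
    apply: ler_wpM2r; first exact: mulr_ge0 (mulr_ge0 (ler0n _ 2) sm0) uI0.
    apply: mulr_ile1.
    - by rewrite divr_ge0// mulr_ge0// ltW.
    - by rewrite divr_ge0 ?(ltW u0)// mulr_ge0 ?exprn_ge0 ?ltW.
    - by rewrite ler_pdivrMr ?mulr_gt0// mul1r.
    rewrite ler_pdivrMr ?mulr_gt0 ?exprn_gt0// mul1r exprS mulrCA.
    by rewrite ler_peMr ?(ltW u0)// mulr_ege1// exprn_ege1.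
  have EdE : A1 * u * Ed <= A1 * (2 * K0%:R / kappa * (Q1 + Q2 * (1 + lnT)) / u).
    rewrite -mulrA ler_wpM2l//; apply: le_trans _ smE.
    by rewrite ler_wpM2l// ltW.
  have lA : u^-1 <= l * lnT / u by rewrite ler_peMl.
  have e1 : (4 + lnT) / u <= (4 * l + 1) * (lnT / u).
    rewrite (_ : (4 * l + 1) * (lnT / u) = (4 * (l * lnT) + lnT) / u); last by ring.
    by rewrite ler_wpM2r// lerD2r ler_peMr.
  have e2 : (Q1 + Q2 * (1 + lnT)) / u <= (Q1 * l + Q2 * (l + 1)) * (lnT / u).
    rewrite (_ : _ * (lnT / u) = (Q1 * (l * lnT) + Q2 * (l * lnT + lnT)) / u); last by ring.
    by rewrite ler_wpM2r// lerD ?ler_peMr// ler_wpM2l// lerD2r.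
  have f1 : mu * D ^+ 2 * c * (4 + lnT) / u <=
      mu * D ^+ 2 * c * ((4 * l + 1) * (lnT / u)).
    rewrite -mulrA ler_wpM2l//.
    exact: mulr_ge0 (mulr_ge0 (ltW mu0) (sqr_ge0 _)) (ltW c0).
  have f2 : 2 * K0%:R / kappa * (Q1 + Q2 * (1 + lnT)) / u <=
      2 * K0%:R / kappa * ((Q1 * l + Q2 * (l + 1)) * (lnT / u)).
    by rewrite -mulrA ler_wpM2l// divr_ge0 ?mulr_ge0// ltW.
  have f4 := ler_wpM2l A10 lA.
  have f5 := ler_wpM2l A10 f2.
  rewrite [leRHS](_ : _ = mu * D ^+ 2 * c * ((4 * l + 1) * (lnT / u))
    + A1 * (l * lnT / u)
    + A1 * (2 * K0%:R / kappa * ((Q1 * l + Q2 * (l + 1)) * (lnT / u)))); last by ring.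
  by rewrite !lerD// ?(le_trans gq)// (le_trans EdE).
rewrite unlock; apply: le_trans _ (_ : (Rintegral P setT bound)%:E <= _)%E; last first.
  by rewrite lee_fin.
rewrite /Rintegral fineK; last exact: integrable_fin_num.
have gE w : GAP XX V (pi T.+1 w) = g (pif T.+1 w) := GAP_flat X V (pi T.+1 w).
apply: ge0_le_integral => //.
- by move=> w _; rewrite lee_fin gE (gap_ge0 Wzeta SD).
- apply/measurable_EFinP; have [Pj PjP] := choice (fun y => projection_exists cptS cvxS y S0).
  (* Along the trajectory the gap agrees with [g \o Pj], which is Lipschitz on the whole space. *)
  have -> : (fun w => GAP XX V (pi T.+1 w)) = fun w => g (Pj (pif T.+1 w)).
    apply/funext => w; rewrite gE; congr g.
    exact: projection_uniq (projection_id (SpT w)) (PjP _).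
  apply: (@measurable_lipschitz R _ _ Omega _ (fun y => g (Pj y)) A1).
    apply: (iterate_feedback_measurable cptS cvxS L0 Wlip Sp1 traj _ _).1.
      by move=> t tT; have [] := noisef t tT.
    by rewrite leqnn andbT.
  move=> a b; have ab : A1 * l2norm (Pj a - Pj b) <= A1 * l2norm (a - b).
    by rewrite ler_wpM2l// (projection_nonexpansive (PjP _) (PjP _)).
  have := gap_lipschitz Wlip Wzeta SD (PjP a).1 (PjP b).1.
  have := gap_lipschitz Wlip Wzeta SD (PjP b).1 (PjP a).1.
  rewrite (l2normBC (Pj b)) -/A1 -/g => h1 h2.
  by rewrite ler_norml; apply/andP; split; lra.
- by case/integrableP: ibound.
- by move=> w _; rewrite lee_fin gE gbound.
Qed.
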